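(* Let $G$ be a non-solvable GBS group, with center $Z(G)$. Then $$\Sigma(G)=S(G,Z(G))^c.$$ If the center is trivial, $\Sigma(G)=\emptyset$. If not, $\Sigma(G)$ is the complement of a codimension 1 rationally defined subsphere of $S(G)$.
   Context: A GBS group (generalized Baumslag-Solitar group) is the fundamental group of a finite graph of groups all of whose vertex and edge groups are infinite cyclic. For a finitely generated group $G$, $S(G)$ is the sphere (of dimension $b_1(G)-1$, with $b_1(G)$ the first Betti number) of classes $[\varphi]$ of nonzero homomorphisms $\varphi:G\to\mathbb{R}$, where $[\varphi]=[\psi]$ iff $\varphi=\lambda\psi$ for some real $\lambda>0$. For a finite generating set $\mathcal{G}$ of $G$, $\mathrm{Cay}(G,\mathcal{G})$ is the Cayley graph with vertex set $G$ and edges joining $g$ to $gs$ for $s\in\mathcal{G}$, and $\mathrm{Cay}(G,\mathcal{G})^{[0,\infty)}$ is its induced subgraph on $\{g:\varphi(g)\ge0\}$. The Bieri-Neumann-Strebel invariant $\Sigma(G)\subset S(G)$ is the set of $[\varphi]$ such that $\mathrm{Cay}(G,\mathcal{G})^{[0,\infty)}$ is connected for some (equivalently every) finite generating set $\mathcal{G}$. For a subgroup $H\subset G$, $S(G,H)=\{[\varphi]\in S(G):H\subset\ker\varphi\}$ and $S(G,H)^c$ is its complement in $S(G)$. A rationally defined subsphere of codimension $d$ is the set of classes of nonzero elements of a codimension $d$ linear subspace of $\mathrm{Hom}(G,\mathbb{R})$ defined over $\mathbb{Q}$ (it is empty if the subspace is $0$). *)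

(* Defs.v *)
From HB Require Import structures.
From Stdlib Require Import Relation_Operators.
From mathcomp Require Import all_boot all_order all_algebra.
From mathcomp Require Import all_classical all_reals.

Set Implicit Arguments.
Unset Strict Implicit.
Unset Printing Implicit Defensive.

Import Order.TTheory GRing.Theory Num.Theory.
Local Open Scope classical_set_scope.
Local Open Scope ring_scope.

Section Groups.
Variable G : groupType.
Local Open Scope group_scope.

Definition is_subgroup (H : set G) : Prop :=
  H 1 /\ forall x y, H x -> H y -> H (x / y).

Definition subgroup_gen (A : set G) : set G :=
  [set g | forall H, is_subgroup H -> A `<=` H -> H g].

Definition group_center : set G := [set z | forall g, z * g = g * z].

Fixpoint derived_series (n : nat) : set G :=
  if n is m.+1 then
    subgroup_gen [set g | exists x y,
      [/\ derived_series m x, derived_series m y & g = [~ x, y]]]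
  else setT.

Definition solvable_group : Prop := exists n, derived_series n = [set 1].

End Groups.

Definition infinite_cyclic (C : groupType) : Prop :=
  exists f : int -> C,
    bijective f /\ forall m n : int, f (m + n) = (f m * f n)%g.

(* A letter (x, false) stands for the generator x, (x, true) for its inverse. *)
Definition word (X : Type) : Type := seq (X * bool).

(* Equality of words in the group < X | rels >: the congruence generated by
   free cancellation and by the relators. *)
Inductive pres_eq (X : Type) (rels : set (word X)) : word X -> word X -> Prop :=
| pres_refl w : pres_eq rels w w
| pres_sym w w' : pres_eq rels w w' -> pres_eq rels w' w
| pres_trans w w' w'' :
    pres_eq rels w w' -> pres_eq rels w' w'' -> pres_eq rels w w''
| pres_cat u u' w w' :
    pres_eq rels u u' -> pres_eq rels w w' -> pres_eq rels (u ++ w) (u' ++ w')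
| pres_cancel x b : pres_eq rels [:: (x, b); (x, ~~ b)] [::]
| pres_rel r : rels r -> pres_eq rels r [::].

Definition word_eval (X : Type) (G : groupType) (f : X -> G) (w : word X) : G :=
  (\prod_(l <- w) (if l.2 then (f l.1)^-1 else f l.1))%g.

(* f induces an isomorphism from < X | rels > onto G. *)
Definition is_presentation (X : Type) (rels : set (word X)) (G : groupType)
    (f : X -> G) : Prop :=
  (forall g, exists w, word_eval f w = g) /\
  (forall w w', word_eval f w = word_eval f w' <-> pres_eq rels w w').

(* The underlying graph is a finite multigraph (loops allowed), each geometric
   edge being given with an arbitrary orientation. *)
Record graph_of_groups := GraphOfGroups {
  gg_vert : finType;
  gg_edge : finType;
  gg_src : gg_edge -> gg_vert;
  gg_tgt : gg_edge -> gg_vert;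
  gg_vgroup : gg_vert -> groupType;
  gg_egroup : gg_edge -> groupType;
  gg_src_map : forall e, {multiplicative gg_egroup e -> gg_vgroup (gg_src e)};
  gg_tgt_map : forall e, {multiplicative gg_egroup e -> gg_vgroup (gg_tgt e)};
  gg_src_inj : forall e, injective (gg_src_map e);
  gg_tgt_inj : forall e, injective (gg_tgt_map e)
}.

Section FundamentalGroup.
Variable Gamma : graph_of_groups.
Implicit Type T : {set gg_edge Gamma}.

(* Oriented edges: (e, false) is e traversed from source to target and
   (e, true) is the reverse edge. *)
Definition dart : Type := (gg_edge Gamma * bool)%type.
Definition dart_src (d : dart) := if d.2 then gg_tgt d.1 else gg_src d.1.
Definition dart_tgt (d : dart) := if d.2 then gg_src d.1 else gg_tgt d.1.
Definition dart_rev (d : dart) : dart := (d.1, ~~ d.2).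

Definition adjacent_in T : rel (gg_vert Gamma) :=
  [rel u v | [exists d : gg_edge Gamma * bool,
     [&& d.1 \in T, dart_src d == u & dart_tgt d == v]]].

Definition circuit_in T (c : seq (gg_edge Gamma * bool)) : bool :=
  [&& c != [::], all (fun d => d.1 \in T) c, uniq (map dart_src c) &
      cycle (fun d d' => (dart_tgt d == dart_src d') && (d' != dart_rev d)) c].

Definition spanning_tree T : Prop :=
  [/\ (0 < #|gg_vert Gamma|)%N,
      forall u v, connect (adjacent_in T) u v
    & forall c, ~~ circuit_in T c].

Definition pi1_gen : Type :=
  ({v : gg_vert Gamma & gg_vgroup v} + gg_edge Gamma)%type.
Definition vgen v (x : gg_vgroup v) : pi1_gen :=
  inl (existT (fun v => gg_vgroup v : Type) v x).
Definition egen (e : gg_edge Gamma) : pi1_gen := inr e.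

(* The vertex groups, together with letters t_e such that
   t_e tgt_map(a) t_e^-1 = src_map(a), and t_e = 1 for e in T. *)
Inductive pi1_relator T : word pi1_gen -> Prop :=
| relator_mul v (x y : gg_vgroup v) :
    pi1_relator T
      [:: (vgen x, false); (vgen y, false); (vgen (x * y)%g, true)]
| relator_edge e (a : gg_egroup e) :
    pi1_relator T
      [:: (egen e, false); (vgen (gg_tgt_map e a), false);
          (egen e, true); (vgen (gg_src_map e a), true)]
| relator_tree e : e \in T -> pi1_relator T [:: (egen e, false)].

Definition is_fundamental_group (G : groupType) : Prop :=
  exists2 T, spanning_tree T &
    exists f : pi1_gen -> G, is_presentation (pi1_relator T) f.

End FundamentalGroup.

Definition GBS_group (G : groupType) : Prop :=
  exists Gamma : graph_of_groups,
    [/\ forall v : gg_vert Gamma, infinite_cyclic (gg_vgroup v),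
        forall e : gg_edge Gamma, infinite_cyclic (gg_egroup e)
      & is_fundamental_group Gamma G].

Section BNS.
Variables (R : realType) (G : groupType).
Implicit Types (phi psi : G -> R) (H A : set G).

Definition real_hom : set (G -> R) :=
  [set phi | forall x y, phi (x * y)%g = phi x + phi y].

Definition nonzero_hom : set (G -> R) :=
  [set phi | real_hom phi /\ exists g, phi g != 0].

(* The class [phi], as a set of homomorphisms: an open half-line. *)
Definition ray phi : set (G -> R) :=
  [set psi | exists2 lambda : R, 0 < lambda & psi = (fun g => lambda * phi g)].

Definition sphere : set (set (G -> R)) := [set ray phi | phi in nonzero_hom].

(* S(G, H) *)
Definition sphere_vanishing H : set (set (G -> R)) :=
  [set ray phi | phi in nonzero_hom `&` [set phi | forall h, H h -> phi h = 0]].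

Definition cayley_edge A (g h : G) : Prop := exists2 s, A s & h = (g * s)%g.

(* Connectedness of the subgraph induced on V by the graph with (unoriented)
   edges adj. *)
Definition induced_connected (adj : G -> G -> Prop) (V : set G) : Prop :=
  forall x y, V x -> V y ->
    clos_refl_sym_trans G (fun a b => [/\ V a, V b & adj a b]) x y.

Definition finite_generating_set A : Prop :=
  finite_set A /\ subgroup_gen A = setT.

Definition BNS_invariant : set (set (G -> R)) :=
  [set ray phi | phi in nonzero_hom `&`
    [set phi | exists2 A, finite_generating_set A &
       induced_connected (cayley_edge A) [set g | 0 <= phi g]]].

Definition hom_subspace (W : set (G -> R)) : Prop :=
  [/\ W `<=` real_hom, W (fun=> 0) &
      forall (a : R) phi psi, W phi -> W psi -> W (fun g => a * phi g + psi g)].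

(* Some d homomorphisms map to a basis of the quotient Hom(G, R) / W. *)
Definition hom_codim (W : set (G -> R)) (d : nat) : Prop :=
  exists f : 'I_d -> G -> R,
    (forall i, real_hom (f i)) /\
    forall phi, real_hom phi ->
      exists! a : 'rV[R]_d, W (fun g => phi g - \sum_i a 0 i * f i g).

Definition rational_valued phi : Prop := forall g, exists q : rat, phi g = ratr q.

(* W is spanned over R by its elements lying in Hom(G, Q). *)
Definition defined_over_Q (W : set (G -> R)) : Prop :=
  forall phi, W phi ->
    exists n (a : 'I_n -> R) (f : 'I_n -> G -> R),
      (forall i, W (f i) /\ rational_valued (f i)) /\
      phi = (fun g => \sum_i a i * f i g).

Definition rational_subsphere (d : nat) (S : set (set (G -> R))) : Prop :=
  exists W : set (G -> R),
    [/\ hom_subspace W, hom_codim W d, defined_over_Q W &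
        S = [set ray phi | phi in W `&` nonzero_hom]].

End BNS.

Arguments group_center G : clear implicits.
Arguments sphere R G : clear implicits.
Arguments sphere_vanishing R {G} H.
Arguments BNS_invariant R G : clear implicits.

(* Main.v *)
Require Import Defs.
From mathcomp Require Import all_boot all_order all_algebra.
From mathcomp Require Import all_classical all_reals.
From mathcomp Require Import zify ring lra.
Local Open Scope classical_set_scope.

(* A homomorphism phi that does not vanish on the center is in Sigma: pushing a
   path by a high power of a central z with phi(z) > 0 makes it positive. If phi
   vanishes on the center, then it vanishes on the vertex groups, since otherwise
   phi makes all vertex generators commensurable with rational ratios compatible
   with the edge relations, and some power of them is central. For such a phi,
   the height on the Bass-Serre tree defined by phi is considered: if some edge
   has unbounded height on both sides, its translates of low height cut the
   subgraph {phi >= 0} of any Cayley graph. If no edge does, all edges are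
   oriented towards the unbounded side, with one edge of label +-1 leaving each
   vertex; then G is an ascending HNN extension of a cyclic group, hence
   solvable. The same orientation argument, with the direction of a central
   element that acts hyperbolically, shows that a nontrivial center meets the
   vertex groups; the edge relations are then compatible with a homomorphism
   G -> Q that is injective on the vertex groups, which gives the codimension 1.
   The Bass-Serre tree is made concrete by normal forms, whose uniqueness comes
   from an explicit action of G on them. *)

Set Implicit Arguments.
Unset Strict Implicit.
Unset Printing Implicit Defensive.

Import Order.TTheory GRing.Theory Num.Theory.
Local Open Scope ring_scope.

(** * Splittings with infinite cyclic groups *)

(* With a_v a generator of the vertex group at v: al v k = a_v^k, tau d = t_e^(+-1),
   and a generator of the edge group of d is a_(dart_src d)^(lab d), as well as
   a_(dart_tgt d)^(lab (dart_rev d)). *)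
Record cyclic_splitting (Gamma : graph_of_groups) (T : {set gg_edge Gamma})
    (G : groupType) := CyclicSplitting {
  lab : dart Gamma -> int;
  al : gg_vert Gamma -> int -> G;
  tau : dart Gamma -> G;
  lab_neq0 : forall d, lab d != 0;
  alD : forall v k l, al v (k + l) = (al v k * al v l)%g;
  tau_rev : forall d, tau (dart_rev d) = (tau d)^-1%g;
  tau_rel : forall d k, (tau d * al (dart_tgt d) (lab (dart_rev d) * k) =
                         al (dart_src d) (lab d * k) * tau d)%g;
  tau_tree : forall d, d.1 \in T -> tau d = 1%g;
  gen_ind : forall P : G -> Prop, P 1%g ->
    (forall g v k, P g -> P (g * al v k)%g) ->
    (forall g d, P g -> P (g * tau d)%g) -> forall g, P g;
  (* Universal property of the presentation, for right actions of G on {x | P x}. *)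
  split_univ : forall (X : Type) (P : X -> Prop)
    (sh : gg_vert Gamma -> int -> X -> X) (cr : dart Gamma -> X -> X),
    (forall v k x, P x -> P (sh v k x)) -> (forall d x, P x -> P (cr d x)) ->
    (forall v x, P x -> sh v 0 x = x) ->
    (forall v k l x, P x -> sh v (k + l) x = sh v l (sh v k x)) ->
    (forall d x, P x -> cr (dart_rev d) (cr d x) = x) ->
    (forall d k x, P x -> sh (dart_tgt d) (lab (dart_rev d) * k) (cr d x) =
                          cr d (sh (dart_src d) (lab d * k) x)) ->
    (forall d x, P x -> d.1 \in T -> cr d x = x) ->
    exists act : G -> X -> X,
      [/\ forall x, P x -> act 1%g x = x,
          forall g h x, P x -> act (g * h)%g x = act h (act g x),
          forall v k x, P x -> act (al v k) x = sh v k x &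
          forall d x, P x -> act (tau d) x = cr d x]
}.

Arguments al {Gamma T G}.
Arguments tau {Gamma T G}.
Arguments lab {Gamma T G}.
Arguments gen_ind {Gamma T G}.

Lemma dart_revK (Gamma : graph_of_groups) : involutive (@dart_rev Gamma).
Proof. by case=> e []. Qed.

Lemma dart_src_rev (Gamma : graph_of_groups) (d : dart Gamma) :
  dart_src (dart_rev d) = dart_tgt d.
Proof. by case: d => e []. Qed.

Lemma dart_tgt_rev (Gamma : graph_of_groups) (d : dart Gamma) :
  dart_tgt (dart_rev d) = dart_src d.
Proof. by case: d => e []. Qed.

Lemma dart_rev_neq (Gamma : graph_of_groups) (d : dart Gamma) :
  dart_rev d <> d.
Proof. by case: d => e []. Qed.

Lemma word_eval_cat (X : Type) (G : groupType) (f : X -> G) u w :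
  word_eval f (u ++ w) = (word_eval f u * word_eval f w)%g.
Proof. by rewrite /word_eval big_cat. Qed.

(** * Splittings read off a presentation *)

Section FromPresentation.
Variables (Gamma : graph_of_groups) (G : groupType) (T : {set gg_edge Gamma}).
Variables (f : pi1_gen Gamma -> G).
Hypothesis pres : is_presentation (pi1_relator T) f.
Variables (c : forall v : gg_vert Gamma, int -> gg_vgroup v)
  (c' : forall v : gg_vert Gamma, gg_vgroup v -> int).
Hypotheses (cK : forall v, cancel (@c v) (@c' v))
  (c'K : forall v, cancel (@c' v) (@c v))
  (cD : forall v (m n : int), c v (m + n) = (c v m * c v n)%g).
Variables (ce : forall e : gg_edge Gamma, int -> gg_egroup e)
  (ce' : forall e : gg_edge Gamma, gg_egroup e -> int).
Hypotheses (ceK : forall v, cancel (@ce v) (@ce' v))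
  (ce'K : forall v, cancel (@ce' v) (@ce v))
  (ceD : forall e (m n : int), ce e (m + n) = (ce e m * ce e n)%g).

Lemma int_morph_eq (h : int -> int) :
  (forall m n, h (m + n) = h m + h n) -> forall k, h k = h 1 * k.
Proof.
move=> hD.
have h0 : h 0 = 0 by have := hD 0 0; rewrite addr0; lia.
have hN k : h (- k) = - h k by have := hD (- k) k; rewrite addNr h0; lia.
elim/int_ind => [|n IH|n IH]; first by rewrite h0 mulr0.
  by rewrite -addn1 PoszD hD IH; ring.
by rewrite -addn1 PoszD opprD hD IH hN; ring.
Qed.

Definition src_exp e k : int := c' (gg_src_map e (ce e k)).
Definition tgt_exp e k : int := c' (gg_tgt_map e (ce e k)).

Lemma c'M v (x y : gg_vgroup v) : c' (x * y)%g = c' x + c' y.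
Proof. by apply: (can_inj (@cK v)); rewrite cD !c'K. Qed.

Lemma src_expE e k : src_exp e k = src_exp e 1 * k.
Proof. by apply: int_morph_eq => m n; rewrite /src_exp ceD gmulfM c'M. Qed.

Lemma tgt_expE e k : tgt_exp e k = tgt_exp e 1 * k.
Proof. by apply: int_morph_eq => m n; rewrite /tgt_exp ceD gmulfM c'M. Qed.

Definition ex_lab (d : dart Gamma) : int :=
  if d.2 then tgt_exp d.1 1 else src_exp d.1 1.
Definition ex_al v k : G := f (vgen (c v k)).
Definition ex_tau (d : dart Gamma) : G :=
  if d.2 then (f (egen d.1))^-1%g else f (egen d.1).

Lemma ex_lab_neq0 d : ex_lab d != 0.
Proof.
rewrite /ex_lab; case: d => e b /=; apply/eqP => h0.
suff : 1 = 0 :> int by [].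
apply: (can_inj (@ceK e)).
case: b h0 => h0.
  apply: (@gg_tgt_inj _ e); apply: (can_inj (@c'K _)).
  by rewrite -!/(tgt_exp _ _) (tgt_expE e 0) h0.
apply: (@gg_src_inj _ e); apply: (can_inj (@c'K _)).
by rewrite -!/(src_exp _ _) (src_expE e 0) h0.
Qed.

Lemma relator_eval r : pi1_relator T r -> word_eval f r = 1%g.
Proof.
move=> hr; have [_ h] := pres; have <- : word_eval f [::] = 1%g.
  by rewrite /word_eval big_nil.
by apply/h/pres_rel.
Qed.

Lemma ex_alD v k l : ex_al v (k + l) = (ex_al v k * ex_al v l)%g.
Proof.
have := relator_eval (relator_mul T (c v k) (c v l)).
rewrite /word_eval !big_cons big_nil /= mulg1 mulgA => /divg1_eq.
by rewrite /ex_al cD => ->.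
Qed.

Lemma ex_tau_rev d : ex_tau (dart_rev d) = (ex_tau d)^-1%g.
Proof. by case: d => e [] //=; rewrite /ex_tau /= invgK. Qed.

Lemma ex_tau_rel d k : (ex_tau d * ex_al (dart_tgt d) (ex_lab (dart_rev d) * k)
  = ex_al (dart_src d) (ex_lab d * k) * ex_tau d)%g.
Proof.
have h e : (f (egen e) * ex_al (gg_tgt e) (tgt_exp e k) =
            ex_al (gg_src e) (src_exp e k) * f (egen e))%g.
  have := relator_eval (relator_edge T (ce e k)).
  rewrite /word_eval !big_cons big_nil /= mulg1 !mulgA => /divg1_eq.
  by rewrite /ex_al /tgt_exp /src_exp !c'K => <-; rewrite mulgVK.
case: d => e [] /=; rewrite /ex_tau /ex_lab /dart_tgt /dart_src /=; last first.
  by rewrite -src_expE -tgt_expE.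
apply: (mulgI (f (egen e))); apply: (mulIg (f (egen e))).
by rewrite -src_expE -tgt_expE !mulgA mulgV mul1g h mulgVK.
Qed.

Lemma ex_tau_tree d : d.1 \in T -> ex_tau d = 1%g.
Proof.
move=> /relator_tree /relator_eval; rewrite /word_eval big_cons big_nil mulg1 /=.
by rewrite /ex_tau => ->; rewrite invg1 if_same.
Qed.

Lemma ex_al0 v : ex_al v 0 = 1%g.
Proof. by apply: (mulIg (ex_al v 0)); rewrite -ex_alD mul1g. Qed.

Lemma ex_gen_ind (P : G -> Prop) : P 1%g ->
    (forall g v k, P g -> P (g * ex_al v k)%g) ->
    (forall g d, P g -> P (g * ex_tau d)%g) -> forall g, P g.
Proof.
move=> P1 Pal Ptau g; have [/(_ g)[w <-] _] := pres.
elim/last_ind: w => [|w [l b] IH]; first by rewrite /word_eval big_nil.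
rewrite -cats1 word_eval_cat {2}/word_eval big_cons big_nil mulg1 /=.
case: l => [[v x]|e].
  have E k : f (inl (existT _ v (c v k))) = ex_al v k by [].
  case: b; rewrite -[x](@c'K v) E; last exact: Pal.
  have -> : ((ex_al v (c' x))^-1 = ex_al v (- c' x))%g.
    by apply: mulg1_eq; rewrite -ex_alD addrN ex_al0.
  exact: Pal.
by case: b; [apply: (Ptau _ (e, true))|apply: (Ptau _ (e, false))].
Qed.

Section Univ.
Variables (X : Type) (P : X -> Prop)
    (sh : gg_vert Gamma -> int -> X -> X) (cr : dart Gamma -> X -> X).
Hypotheses (Psh : forall v k x, P x -> P (sh v k x))
  (Pcr : forall d x, P x -> P (cr d x))
  (sh0 : forall v x, P x -> sh v 0 x = x)
  (shD : forall v k l x, P x -> sh v (k + l) x = sh v l (sh v k x))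
  (crK : forall d x, P x -> cr (dart_rev d) (cr d x) = x)
  (sh_cr : forall d k x, P x ->
     sh (dart_tgt d) (ex_lab (dart_rev d) * k) (cr d x) =
     cr d (sh (dart_src d) (ex_lab d * k) x))
  (crT : forall d x, P x -> d.1 \in T -> cr d x = x).

Definition letter_act (x : X) (l : pi1_gen Gamma * bool) : X :=
  match l.1 with
  | inl (existT v y) => sh v (if l.2 then - c' y else c' y) x
  | inr e => cr (e, l.2) x
  end.
Definition word_act (w : word (pi1_gen Gamma)) x := foldl letter_act x w.

Lemma letter_actP l x : P x -> P (letter_act x l).
Proof. by case: l => [[[v y]|e] b] Px; [apply: Psh|apply: Pcr]. Qed.

Lemma word_actP w x : P x -> P (word_act w x).
Proof. by elim: w x => //= l w IH x Px; apply/IH/letter_actP. Qed.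

Lemma word_act_cat u w x : word_act (u ++ w) x = word_act w (word_act u x).
Proof. exact: foldl_cat. Qed.

Lemma letter_actK g b x : P x -> word_act [:: (g, b); (g, ~~ b)] x = x.
Proof.
move=> Px; case: g => [[v y]|e]; rewrite /word_act /letter_act /=; last first.
  exact: (@crK (e, b)).
by rewrite -shD //; case: b => /=; rewrite ?addNr ?addrN sh0.
Qed.

(** The hypotheses on [sh] and [cr] make each relator act trivially on P; stability of P lets the
    induction pass through concatenations. *)
Lemma word_act_eq w w' : pres_eq (pi1_relator T) w w' ->
  forall x, P x -> word_act w x = word_act w' x.
Proof.
elim=> //.
- by move=> {}w {}w' _ IH x Px; rewrite IH.
- by move=> w1 w2 w3 _ IH1 _ IH2 x Px; rewrite IH1 // IH2.
- move=> u u' w1 w2 _ IH1 _ IH2 x Px; rewrite !word_act_cat IH1 // IH2 //.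
  exact: word_actP.
- by move=> g b x Px; rewrite letter_actK.
move=> r [v y z|e a|e eT] x Px.
- rewrite /word_act /letter_act /= -!shD ?c'M ?addrN ?sh0 //; try exact: Psh.
  by rewrite (addrA (c' y)) addrN sh0.
- rewrite /word_act /letter_act /=.
  have /= := @sh_cr (e, false) (ce' a) x Px.
  rewrite /ex_lab /dart_tgt /dart_src /= -src_expE -tgt_expE.
  rewrite /src_exp /tgt_exp ce'K => ->.
  have /= -> := @crK (e, false) _ (Psh (gg_src e) (c' (gg_src_map e a)) Px).
  by rewrite -shD // addrN sh0.
- exact: crT.
Qed.

(** Each g acts through a chosen word, and by [word_act_eq] the choice does not matter. *)
Lemma ex_univ : exists act : G -> X -> X,
      [/\ forall x, P x -> act 1%g x = x,
          forall g h x, P x -> act (g * h)%g x = act h (act g x),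
          forall v k x, P x -> act (ex_al v k) x = sh v k x &
          forall d x, P x -> act (ex_tau d) x = cr d x].
Proof.
have [ex_w h] := pres.
pose wd g := sval (cid (ex_w g)).
have wdE g : word_eval f (wd g) = g by rewrite /wd; case: cid.
have actE w g x : P x -> word_eval f w = g -> word_act (wd g) x = word_act w x.
  by move=> Px wg; apply: word_act_eq => //; apply/h; rewrite wdE.
exists (fun g => word_act (wd g)); split.
- by move=> x Px; rewrite (actE [::]) // /word_eval big_nil.
- move=> g k x Px; rewrite (actE (wd g ++ wd k)) ?word_act_cat //.
  by rewrite word_eval_cat !wdE.
- move=> v k x Px; rewrite (actE [:: (vgen (c v k), false)]) //.
    by rewrite /word_act /letter_act /= cK.
  by rewrite /word_eval big_cons big_nil mulg1.
- move=> [e b] x Px; rewrite (actE [:: (egen e, b)]) //.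
  by rewrite /word_eval big_cons big_nil mulg1 /ex_tau.
Qed.
End Univ.

Lemma ex_splitting : inhabited (cyclic_splitting T G).
Proof.
exact: (inhabits (CyclicSplitting ex_lab_neq0 ex_alD ex_tau_rev ex_tau_rel
  ex_tau_tree ex_gen_ind ex_univ)).
Qed.

End FromPresentation.

Lemma GBS_splitting (G : groupType) : GBS_group G ->
  exists (Gamma : graph_of_groups) (T : {set gg_edge Gamma}),
    spanning_tree T /\ inhabited (cyclic_splitting T G).
Proof.
move=> [Gamma [hv he [T hT [f hf]]]]; exists Gamma, T; split=> //.
have key (I : Type) (C : I -> groupType) : (forall i, infinite_cyclic (C i)) ->
  exists (c : forall i, int -> C i) (c' : forall i, C i -> int),
   [/\ forall i, cancel (c i) (c' i), forall i, cancel (c' i) (c i)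
    & forall i (m n : int), c i (m + n) = (c i m * c i n)%g].
  move=> hC; pose c i := sval (cid (hC i)).
  have hc i : bijective (c i) /\ forall m n : int, c i (m + n) = (c i m * c i n)%g.
    by rewrite /c; case: cid.
  have hb i : exists g, cancel (c i) g /\ cancel g (c i).
    by have [[g h1 h2] _] := hc i; exists g.
  pose c' i := sval (cid (hb i)).
  exists c, c'; split=> i; first by have [] := svalP (cid (hb i)).
    by have [] := svalP (cid (hb i)).
  by have [] := hc i.
have [c [c' [h1 h2 h3]]] := key _ _ hv.
have [ce [ce' [h4 h5 h6]]] := key _ _ he.
exact: (ex_splitting hf h1 h2 h3 h4 h5 h6).
Qed.

(** * Paths in a spanning tree *)

Section TreePaths.
Variables (Gamma : graph_of_groups) (T : {set gg_edge Gamma}).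
Hypothesis hT : spanning_tree T.
Local Notation V := (gg_vert Gamma).
Local Notation D := (gg_edge Gamma * bool)%type.
Local Notation ds := (@dart_src Gamma).
Local Notation dt := (@dart_tgt Gamma).
Local Notation drev := (@dart_rev Gamma).

Fixpoint dwalk (u : V) (p : seq D) (v : V) : bool :=
  if p is d :: p' then [&& ds d == u, d.1 \in T & dwalk (dt d) p' v]
  else u == v.

Lemma dwalk_rcons u p d : dwalk u (rcons p d) (dt d) =
  dwalk u p (ds d) && (d.1 \in T).
Proof.
elim: p u => [|e p IH] u /=; first by rewrite eqxx andbT eq_sym.
by rewrite IH !andbA.
Qed.

Lemma dwalk_tgt d p v : dwalk (dt d) p v -> dt d \in rcons (map ds p) v.
Proof.
case: p => [/eqP->|e p /= /and3P[/eqP-> _ _]]; rewrite ?inE ?eqxx //.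
Qed.

Definition step_ok (d d' : D) := (dt d == ds d') && (d' != drev d).

Lemma dwalk_nonback x p e d : dwalk x p (ds d) -> dt e = x ->
  uniq (ds e :: rcons (map ds p) (ds d)) -> dt d \notin ds e :: map ds p ->
  path step_ok e (rcons p d).
Proof.
elim: p x e => [|p1 p IH] x e /=.
  move=> /eqP-> E; rewrite /step_ok E eqxx !inE !andbT /= => _ h.
  by apply: contraNneq h => ->; rewrite dart_tgt_rev.
move=> /and3P[/eqP h1 _ h2] h3 /andP[h4 h5] h6.
rewrite {1}/step_ok h1 h3 eqxx /=; apply/andP; split; last first.
  by apply: (IH (dt p1)) => //; move: h6; rewrite inE negb_or => /andP[].
apply: contraNneq h4 => E; have := dwalk_tgt h2.
by rewrite E dart_tgt_rev inE => ->; rewrite orbT.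
Qed.

(** Leaving S by d, returning by e and closing up inside S along p would form a circuit in T. *)
Lemma no_bypass (S : {set V}) (d e : D) p : d.1 \in T -> e.1 \in T ->
  ds d \in S -> dt d \notin S -> ds e = dt d -> dt e \in S -> e.1 != d.1 ->
  dwalk (dt e) p (ds d) -> uniq (rcons (map ds p) (ds d)) ->
  all (fun x => ds x \in S) p -> False.
Proof.
move=> dT eT dS dnS ed eS ne hp up pS.
have [_ _ /(_ [:: d, e & p]) /negP] := hT; apply.
have pT : all (fun d => d.1 \in T) p.
  by elim: (p) (dt e) hp => //= q p' IH u /and3P[_ -> /IH].
have uS : dt d \notin map ds p.
  by apply: contra dnS => /mapP[q qp ->]; apply: (allP pS).
have hne : e != drev d by apply: contraNneq ne => ->.
apply/and4P; split=> //=; first by rewrite dT eT pT.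
- move: up; rewrite inE negb_or ed uS rcons_uniq => /andP[-> ->] /=.
  by rewrite !andbT; apply: contraNneq dnS => <-.
- rewrite ed eqxx hne /=.
  case: p hp up pS pT uS => [|p1 p] /=.
    move=> /eqP -> _ _ _ _; rewrite eqxx /= andbT.
    by apply: contraNneq ne => ->.
  move=> /and3P[/eqP h1 _ h2] h3 /andP[p1S pS] _ uS; rewrite h1 eqxx /=.
  apply/andP; split; last exact: (dwalk_nonback h2).
  apply: contraNneq dnS => E; have := dwalk_tgt h2.
  rewrite E dart_tgt_rev ed mem_rcons inE => /orP[/eqP->//|].
  by move=> /mapP[q qp ->]; apply: (allP pS).
Qed.

Variable r : V.

(** Invariant for growing a subtree from r; the simple paths inside S feed [no_bypass]. *)
Let grown (S : {set V}) := r \in S /\ exists gam : V -> seq D,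
  [/\ gam r = [::], forall v, v \in S -> dwalk r (gam v) v,
   forall d : D, d.1 \in T -> ds d \in S -> dt d \in S ->
    gam (dt d) = rcons (gam (ds d)) d \/ gam (ds d) = rcons (gam (dt d)) (drev d)
   & forall u v, u \in S -> v \in S -> exists p,
      [/\ dwalk u p v, uniq (rcons (map ds p) v) & all (fun x => ds x \in S) p]].

Let grow_step (S : {set V}) (d : D) : grown S -> d.1 \in T -> ds d \in S ->
  dt d \notin S -> grown (dt d |: S).
Proof.
move=> [rS [gam [g0 gW gT gC]]] dT dS dnS.
have neq x : x \in S -> (x == dt d) = false.
  by move=> xS; apply: contraNF dnS => /eqP <-.
split; first by rewrite !inE rS orbT.
exists (fun x => if x == dt d then rcons (gam (ds d)) d else gam x).
(* A second tree dart from S to the new vertex would create a circuit, so this vertex is a leaf. *)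
have key (e : D) : e.1 \in T -> ds e \in S -> dt e = dt d -> e = d.
  move=> eT eS ed; have [E|ne] := eqVneq e.1 d.1.
    case: d e {eT neq} E dT dS dnS ed eS => [d b] [e b'] /= -> _.
    by case: b; case: b' => //= h1 h2 h3 h4; case/negP: h2; rewrite -?h3.
  have [p [h1 h2 h3]] := gC _ _ eS dS.
  exfalso; apply: (@no_bypass S d (drev e) p) => //.
  - by rewrite dart_src_rev.
  - by rewrite dart_tgt_rev.
  - by rewrite dart_tgt_rev.
split.
- by rewrite neq.
- move=> v; rewrite !inE; case: eqP => [-> _|_ /= vS]; last exact: gW.
  by rewrite dwalk_rcons gW.
- move=> e eT; rewrite !inE.
  case: (eqVneq (ds e) (dt d)) => [se|_ /= eS].
    case: (eqVneq (dt e) (dt d)) => [te|_ _ /= eS].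
      have [_ _ /(_ [:: e]) /negP] := hT; case.
      rewrite /circuit_in /= eT se te eqxx /= andbT.
      by apply/eqP => /esym; apply: dart_rev_neq.
    have := key (drev e) eT; rewrite dart_src_rev dart_tgt_rev => /(_ eS se) ed.
    by right; rewrite -ed dart_src_rev.
  case: (eqVneq (dt e) (dt d)) => [te|_ /= eS']; last exact: gT.
  by move=> _; left; rewrite (key e).
- have PS p : all (fun x => ds x \in S) p ->
    all (fun x => ds x \in dt d |: S) p.
    by apply: sub_all => x; rewrite !inE => ->; rewrite orbT.
  have nP p : all (fun x => ds x \in S) p -> dt d \notin map ds p.
    move=> /allP pS; apply: contra dnS => /mapP[q qp ->]; exact: pS.
  move=> u v; rewrite !inE => /orP[/eqP->|uS] /orP[/eqP->|vS].
  + by exists [::]; rewrite /= eqxx.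
  + have [p [h1 h2 h3]] := gC _ _ dS vS; exists (drev d :: p); split=> /=.
    * by rewrite dart_src_rev dart_tgt_rev eqxx dT.
    * by rewrite dart_src_rev h2 mem_rcons inE eq_sym neq // nP.
    * by rewrite dart_src_rev !inE eqxx PS.
  + have [p [h1 h2 h3]] := gC _ _ uS dS; exists (rcons p d); split=> /=.
    * by rewrite dwalk_rcons h1.
    * rewrite map_rcons rcons_uniq h2 mem_rcons inE eq_sym neq //= nP //.
    * by rewrite all_rcons !inE dS orbT PS.
  + by have [p [h1 h2 h3]] := gC _ _ uS vS; exists p; split=> //; apply: PS.
Qed.

(** Starting from {r}, add the end of a tree dart that leaves S as long as a vertex is missing. The
    last clause will make the edges of T act trivially on normal forms. *)
Lemma tree_paths : exists gam : V -> seq D,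
  [/\ gam r = [::], forall v, dwalk r (gam v) v &
   forall d : D, d.1 \in T ->
    gam (dt d) = rcons (gam (ds d)) d \/ gam (ds d) = rcons (gam (dt d)) (drev d)].
Proof.
suff [S [gS cS]] : exists S, grown S /\ #|~: S| = 0%N.
  have hS x : x \in S.
    move: cS => /eqP; rewrite cards_eq0 => /eqP/setP/(_ x); rewrite !inE.
    by move=> /negbFE.
  have [_ [gam [h1 h2 h3 _]]] := gS; exists gam; split=> //.
  + by move=> v; apply: h2.
  + by move=> d dT; apply: h3.
suff: forall n (S : {set V}), grown S -> #|~: S| = n ->
    exists S, grown S /\ #|~: S| = 0%N.
  apply; last reflexivity; split; first exact: set11.
  exists (fun=> [::]); split=> //.
  - by move=> v; rewrite inE /= eq_sym.
  - move=> d dT; rewrite !inE => /eqP h1 /eqP h2.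
    have [_ _ /(_ [:: d]) /negP] := hT; case.
    rewrite /circuit_in /= dT h1 h2 eqxx /= andbT.
    by apply/eqP => /esym; apply: dart_rev_neq.
  - by move=> u v; rewrite !inE => /eqP-> /eqP->; exists [::]; rewrite /= eqxx.
elim=> [|n IH] S gS cS; first by exists S.
have [d [dT dS dnS]] : exists d : D, [/\ d.1 \in T, ds d \in S & dt d \notin S].
  have [x] : exists x, x \in ~: S by apply/card_gt0P; rewrite cS.
  rewrite inE => xS; have [_ /(_ r x) /connectP[p hp E] _] := hT.
  have : r \in S by case: gS.
  rewrite {x}E in xS; elim: p {gS cS} (r) xS hp => [|y p IHp] u /=.
    by move=> /negP.
  move=> xS /andP[/existsP[d /and3P[dT /eqP du /eqP dy]] hp] uS.
  have [yS|yS] := boolP (y \in S); first exact: (IHp y).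
  by exists d; rewrite du dy.
apply: (IH (dt d |: S)); first exact: grow_step.
rewrite finset.setCU -finset.setDE; have := cardsD1 (dt d) (~: S).
rewrite inE dnS cS /= => -[->]; congr #|pred_of_set _|.
by apply/setP => x; rewrite !inE andbC.
Qed.

End TreePaths.

(** * Normal forms *)

Section NormalForms.
Variables (Gamma : graph_of_groups) (T : {set gg_edge Gamma}) (G : groupType).
Variable S : cyclic_splitting T G.
Local Notation V := (gg_vert Gamma).
Local Notation D := (gg_edge Gamma * bool)%type.
Local Notation ds := (@dart_src Gamma).
Local Notation dt := (@dart_tgt Gamma).
Local Notation drev := (@dart_rev Gamma).
Local Notation lab := (lab S).
Local Notation al := (al S).
Local Notation tau := (tau S).

Lemma al0 v : al v 0 = 1%g.
Proof. by apply: (mulIg (al v 0)); rewrite -alD mul1g. Qed.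

Lemma alN v k : al v (- k) = (al v k)^-1%g.
Proof. by apply/esym/mulg1_eq; rewrite -alD addrN al0. Qed.

(* A link (d, i) stands for a_(ds d)^i t_d with 0 <= i < |lab d|; a reduced
   sequence of links, listed with the last one first, is an edge path of the
   Bass-Serre tree, which is why a link (rev d, 0) may not follow one of dart d. *)
Definition link : Type := (D * int)%type.

Definition endv (v : V) (nu : seq link) : V :=
  if nu is l :: _ then dt l.1 else v.
(** The link that may not come next. F forbids a first link in the same way: for v = [dt d] and F =
    [Some (drev d, 0)], the admissible paths describe the half-tree beyond d. *)
Definition endf (F : option link) (nu : seq link) : option link :=
  if nu is l :: _ then Some (drev l.1, 0) else F.
Definition okl (v : V) (F : option link) (l : link) : bool :=
  [&& ds l.1 == v, 0 <= l.2 < `|lab l.1| & Some l != F].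
Fixpoint adm (v : V) (F : option link) (nu : seq link) : bool :=
  if nu is l :: nu' then adm v F nu' && okl (endv v nu') (endf F nu') l
  else true.
Fixpoint ev (nu : seq link) : G :=
  if nu is l :: nu' then (ev nu' * al (ds l.1) l.2 * tau l.1)%g else 1%g.

Lemma endv_cat v mu nu : endv v (mu ++ nu) = endv (endv v nu) mu.
Proof. by case: mu. Qed.

Lemma endf_cat F mu nu : endf F (mu ++ nu) = endf (endf F nu) mu.
Proof. by case: mu. Qed.

Lemma adm_cat v F mu nu :
  adm v F (mu ++ nu) = adm v F nu && adm (endv v nu) (endf F nu) mu.
Proof.
elim: mu => [|l mu IH] /=; first by rewrite andbT.
by rewrite IH endv_cat endf_cat andbA.
Qed.

Lemma ev_cat mu nu : ev (mu ++ nu) = (ev nu * ev mu)%g.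
Proof. by elim: mu => [|l mu /= ->]; rewrite /= ?mulg1 ?mulgA. Qed.

Definition state : Type := (seq link * int)%type.

(** Right multiplication by t_d. If k = q * lab d + i, then a^k t_d = a^i t_d b^(q * lab (drev d)),
    where a and b generate the vertex groups at the two ends; the new link cancels the last one when
    i = 0 and d reverses its dart. *)
Definition cross (d : D) (s : state) : state :=
  let l' : link := (d, (s.2 %% lab d)%Z) in let q := (s.2 %/ lab d)%Z in
  let new := (l' :: s.1, q * lab (drev d)) in
  if s.1 is l :: nu then
    if l' == (drev l.1, 0) then (nu, l.2 + q * lab l.1) else new
  else new.

Definition shift (k : int) (s : state) : state := (s.1, s.2 + k).

Section Root.
Variable r : V.

Definition okst v (s : state) : bool := adm r None s.1 && (endv r s.1 == v).
Definition evs (s : state) : G := (ev s.1 * al (endv r s.1) s.2)%g.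

Variant cross_spec (d : D) (s : state) : state -> Type :=
| CrossForward : okl (ds d) (endf None s.1) (d, (s.2 %% lab d)%Z) ->
    cross_spec d s
      ((d, (s.2 %% lab d)%Z) :: s.1, (s.2 %/ lab d)%Z * lab (drev d))
| CrossBack l nu q : s = (l :: nu, q * lab d) -> d = drev l.1 ->
    adm r None nu -> okl (endv r nu) (endf None nu) l ->
    cross_spec d s (nu, l.2 + q * lab l.1).

Lemma crossP d s : okst (ds d) s -> cross_spec d s (cross d s).
Proof.
case: s => nu k; rewrite /okst /cross /= => /andP[ha /eqP he].
have fw : Some (d, (k %% lab d)%Z) != endf None nu ->
    okl (ds d) (endf None nu) (d, (k %% lab d)%Z).
  by move=> h; rewrite /okl /= eqxx h modz_ge0 ?ltz_mod ?lab_neq0.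
case: nu ha he fw => [|l nu] ha he fw; first by apply: CrossForward; apply: fw.
case: eqP => [[E1 E2]|ne]; last first.
  by apply: CrossForward; apply: fw; apply/eqP => -[E1 E2]; apply: ne; rewrite -E1 E2.
move: ha => /= /andP[h1 h2].
apply: CrossBack => //; congr (_, _).
by rewrite {1}(divz_eq k (lab d)) E2 addr0.
Qed.

Lemma cross_ok d s : okst (ds d) s -> okst (dt d) (cross d s).
Proof.
move=> hs; have := hs; rewrite /okst => /andP[ha /eqP he].
case: (crossP hs) => [hl|l nu q Es Ed h1 h2] /=.
  by rewrite ha he hl eqxx.
rewrite h1 Ed dart_tgt_rev /=; case/and3P: h2 => /eqP-> _ _.
by rewrite eqxx.
Qed.

Lemma divz_lab d q i : 0 <= i < `|lab d| ->
  ((i + q * lab d) %/ lab d)%Z = q /\ ((i + q * lab d) %% lab d)%Z = i.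
Proof.
move=> hi; have h0 : (i %/ lab d)%Z = 0 by apply: divz_small; rewrite abszE.
rewrite addrC divzMDl ?lab_neq0 // modzMDl h0 addr0; split=> //.
by rewrite [RHS](divz_eq i (lab d)) h0 mul0r add0r.
Qed.

(** After a forward crossing the exponent is a multiple of [lab (drev d)], so the way back cancels.
    After a cancellation, division by the label restores the deleted link, and reducedness keeps it
    from cancelling with the one before. *)
Lemma crossK d s : okst (ds d) s -> cross (drev d) (cross d s) = s.
Proof.
move=> hs; case: (crossP hs) => [hl|l nu q -> -> h1 /and3P[h2 h3 h4]].
  rewrite /cross /= modzMl mulzK ?lab_neq0 // eqxx.
  by case: s {hs hl} => nu k /=; rewrite addrC -divz_eq.
rewrite dart_revK /cross /=; have [-> ->] := divz_lab q h3.
case: l h2 h3 h4 => d' i /= _ _; case: nu {h1} => [//|l' nu] /=.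
by case: ifP => // /eqP ->; rewrite eqxx.
Qed.

Lemma cross_shift d s j : okst (ds d) s ->
  cross d (shift (lab d * j) s) = shift (lab (drev d) * j) (cross d s).
Proof.
case: s => nu k hs; rewrite /cross /shift /= (addrC k) (mulrC _ j).
rewrite modzMDl divzMDl ?lab_neq0 // mulrDl (addrC (j * lab (drev d))).
case: nu hs => [|l nu] hs; first by rewrite (mulrC j).
case: ifP => [/eqP[-> _]|_] /=; rewrite ?dart_revK; congr (_, _); ring.
Qed.

Lemma evs_cross d s : okst (ds d) s -> evs (cross d s) = (evs s * tau d)%g.
Proof.
move=> hs; have := hs; rewrite /okst /evs => /andP[_ /eqP he].
case: (crossP hs) => [hl|l nu q Es Ed h1 /and3P[/eqP h2 _ _]] /=.
  rewrite he -!mulgA; congr (_ * _)%g.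
  by rewrite mulrC tau_rel mulgA -alD mulrC addrC -divz_eq.
rewrite Es Ed /= tau_rev -h2 alD -!mulgA; congr (_ * _)%g; congr (_ * _)%g.
by rewrite (mulrC _ (lab (drev l.1))) mulgA tau_rel mulgK mulrC.
Qed.

Lemma evs_shift k s : evs (shift k s) = (evs s * al (endv r s.1) k)%g.
Proof. by rewrite /evs /= alD mulgA. Qed.

End Root.
End NormalForms.

(** * Uniqueness of normal forms, by an action of the group *)

Section RootedNormalForms.
Variables (Gamma : graph_of_groups) (T : {set gg_edge Gamma}) (G : groupType).
Variable S : cyclic_splitting T G.
Hypothesis hT : spanning_tree T.
Local Notation V := (gg_vert Gamma).
Local Notation D := (gg_edge Gamma * bool)%type.
Local Notation ds := (@dart_src Gamma).
Local Notation dt := (@dart_tgt Gamma).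
Local Notation drev := (@dart_rev Gamma).
Local Notation lab := (lab S).
Local Notation al := (al S).
Local Notation tau := (tau S).
Local Notation state := (state Gamma).

Definition walk (p : seq D) (s : state) : state :=
  foldl (fun s d => cross S d s) s p.
Definition rev_walk (p : seq D) : seq D := rev (map drev p).

Lemma walk_cat p q s : walk (p ++ q) s = walk q (walk p s).
Proof. exact: foldl_cat. Qed.

Lemma rev_walk_cons d p : rev_walk (d :: p) = rcons (rev_walk p) (drev d).
Proof. by rewrite /rev_walk /= rev_cons. Qed.

Lemma rev_walk_rcons d p : rev_walk (rcons p d) = drev d :: rev_walk p.
Proof. by rewrite /rev_walk map_rcons rev_rcons. Qed.

Lemma dwalk_rev u p v : dwalk T u p v -> dwalk T v (rev_walk p) u.
Proof.
elim: p u => [|d p IH] u /=; first by rewrite /rev_walk /= eq_sym.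
move=> /and3P[/eqP<- dT /IH h]; rewrite rev_walk_cons -dart_tgt_rev dwalk_rcons.
by rewrite dart_src_rev h.
Qed.

Variable r : V.

Lemma walk_ok u p v s : dwalk T u p v -> okst S r u s ->
  okst S r v (walk p s) /\ evs S r (walk p s) = evs S r s.
Proof.
elim: p u s => [|d p IH] u s /=; first by move=> /eqP->.
move=> /and3P[/eqP<- dT hp] hs; have [h1 h2] := IH _ _ hp (cross_ok hs).
by split=> //; rewrite h2 evs_cross // tau_tree // mulg1.
Qed.

Lemma walkK u p v s : dwalk T u p v -> okst S r u s ->
  walk (rev_walk p) (walk p s) = s.
Proof.
elim: p u s => [|d p IH] u s //= /and3P[/eqP<- dT hp] hs.
rewrite rev_walk_cons -cats1 walk_cat (IH _ _ hp) ?(cross_ok hs) //=.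
exact: crossK hs.
Qed.

Lemma rev_walkK p : rev_walk (rev_walk p) = p.
Proof.
by rewrite /rev_walk map_rev revK (mapK (@dart_revK Gamma)).
Qed.

Definition gam : V -> seq D := sval (cid (tree_paths hT r)).

Lemma gam_root : gam r = [::].
Proof. by rewrite /gam; case: cid => g []. Qed.

Lemma gam_walk v : dwalk T r (gam v) v.
Proof. by rewrite /gam; case: cid => g []. Qed.

Lemma gam_tree (d : D) : d.1 \in T ->
  gam (dt d) = rcons (gam (ds d)) d \/ gam (ds d) = rcons (gam (dt d)) (drev d).
Proof. by have [_ _ h] := svalP (cid (tree_paths hT r)); apply: h. Qed.

(** As t_e = 1 on T, walking along tree paths changes the end vertex of a normal form but not its
    group element; states ending at r and at v thus correspond. *)
Definition fwd v s := walk (gam v) s.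
Definition bwd v s := walk (rev_walk (gam v)) s.

Lemma fwd_ok v s : okst S r r s -> okst S r v (fwd v s).
Proof. by case/(walk_ok (gam_walk v)). Qed.

Lemma bwd_ok v s : okst S r v s -> okst S r r (bwd v s).
Proof. by case/(walk_ok (dwalk_rev (gam_walk v))). Qed.

Lemma evs_fwd v s : okst S r r s -> evs S r (fwd v s) = evs S r s.
Proof. by case/(walk_ok (gam_walk v)). Qed.

Lemma evs_bwd v s : okst S r v s -> evs S r (bwd v s) = evs S r s.
Proof. by case/(walk_ok (dwalk_rev (gam_walk v))). Qed.

Lemma fwdK v s : okst S r r s -> bwd v (fwd v s) = s.
Proof. exact: walkK (gam_walk v). Qed.

Lemma bwdK v s : okst S r v s -> fwd v (bwd v s) = s.
Proof.
by move=> hs; have := walkK (dwalk_rev (gam_walk v)) hs; rewrite rev_walkK.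
Qed.

Lemma shift_ok u k s : okst S r u (shift k s) = okst S r u s.
Proof. by []. Qed.

Definition ash v k s : state := bwd v (shift k (fwd v s)).
Definition acr d s : state := bwd (dt d) (cross S d (fwd (ds d) s)).

Lemma ash_ok v k s : okst S r r s -> okst S r r (ash v k s).
Proof. by move=> hs; apply: bwd_ok; rewrite shift_ok; apply: fwd_ok. Qed.

Lemma acr_ok d s : okst S r r s -> okst S r r (acr d s).
Proof. by move=> hs; apply: bwd_ok; apply: cross_ok; apply: fwd_ok. Qed.

Lemma evs_ash v k s : okst S r r s -> evs S r (ash v k s) = (evs S r s * al v k)%g.
Proof.
move=> hs; have h := fwd_ok v hs.
rewrite evs_bwd ?shift_ok // evs_shift evs_fwd //.
by move: h => /andP[_ /eqP->].
Qed.

Lemma evs_acr d s : okst S r r s -> evs S r (acr d s) = (evs S r s * tau d)%g.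
Proof.
move=> hs; have h := fwd_ok (ds d) hs.
by rewrite evs_bwd ?cross_ok // evs_cross // evs_fwd.
Qed.

Definition root_state : state := ([::], 0).

Lemma root_ok : okst S r r root_state.
Proof. by rewrite /okst /= eqxx. Qed.

Lemma evs_root : evs S r root_state = 1%g.
Proof. by rewrite /evs /= al0 mulg1. Qed.

Lemma nf_exists g : exists s, okst S r r s /\ evs S r s = g.
Proof.
elim/(gen_ind S): g => [|g v k [s [hs <-]]|g d [s [hs <-]]].
- by exists root_state; rewrite root_ok evs_root.
- by exists (ash v k s); rewrite ash_ok // evs_ash.
- by exists (acr d s); rewrite acr_ok // evs_acr.
Qed.

(** The walks between vertices cancel, which leaves the relations of [shift] and [cross]. For an
    edge of T, one of the two tree paths extends the other by this edge, and the crossings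
    cancel. *)
Lemma root_action : exists act : G -> state -> state,
  [/\ forall s, okst S r r s -> act 1%g s = s,
      forall g h s, okst S r r s -> act (g * h)%g s = act h (act g s),
      forall v k s, okst S r r s -> act (al v k) s = ash v k s &
      forall d s, okst S r r s -> act (tau d) s = acr d s].
Proof.
apply: (@split_univ _ _ _ S _ (fun s => okst S r r s) ash acr).
- exact: ash_ok.
- exact: acr_ok.
- by move=> v s hs; rewrite /ash /shift addr0 -surjective_pairing fwdK.
- move=> v k l s hs; rewrite /ash bwdK ?shift_ok ?fwd_ok //.
  by rewrite /shift /= addrA.
- move=> d s hs; rewrite /acr dart_src_rev dart_tgt_rev bwdK.
    by rewrite (@crossK _ _ _ S r) ?fwdK ?fwd_ok.
  by apply: cross_ok; apply: fwd_ok.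
- move=> d k s hs; have h := fwd_ok (ds d) hs.
  by rewrite /ash /acr !bwdK ?shift_ok ?cross_ok // (@cross_shift _ _ _ S r).
- move=> d s hs /gam_tree[]; rewrite /acr /bwd /fwd => E.
    rewrite E rev_walk_rcons /= (@crossK _ _ _ S r); last exact: fwd_ok.
    exact: fwdK.
  rewrite E -cats1 walk_cat /=.
  have := @crossK _ _ _ S r (drev d) (fwd (dt d) s).
  by rewrite dart_revK dart_src_rev => -> //; [apply: fwdK|apply: fwd_ok].
Qed.

(** The element of a state, applied to the root state, rebuilds this state. *)
Lemma evs_inj s s' : okst S r r s -> okst S r r s' -> evs S r s = evs S r s' ->
  s = s'.
Proof.
have [act [a1 aM aal atau]] := root_action.
suff key nu k : adm S r None nu ->
    act (evs S r (nu, k)) root_state = bwd (endv r nu) (nu, k).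
  have h (u : state) : okst S r r u -> act (evs S r u) root_state = u.
    case: u => nu k /andP[/= h1 /eqP h2].
    by rewrite key // h2 /bwd gam_root.
  by move=> hs hs' E; rewrite -(h s) // E h.
have aok g s0 : okst S r r s0 -> okst S r r (act g s0).
  move=> h0; elim/(gen_ind S): g => [|g v i IH|g d IH]; first by rewrite a1.
    by rewrite aM // aal //; apply: ash_ok.
  by rewrite aM // atau //; apply: acr_ok.
have h0 := root_ok.
elim: nu k => [|l nu IH] k /=.
  rewrite /evs /= mul1g aal // /ash /bwd /fwd gam_root /=.
  by rewrite /root_state /shift /= add0r.
move=> /andP[h1 h2]; rewrite /evs /= aM // aal ?aok // aM // atau ?aok //.
have h3 := h2; case/and3P: h3 => /eqP E hr hf.
have := IH l.2 h1; rewrite /evs /= -E => ->.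
have hnu : okst S r (ds l.1) (nu, l.2) by rewrite /okst /= h1 E eqxx.
rewrite /acr bwdK // /ash bwdK ?cross_ok // /bwd; congr (walk _ _).
have /= : 0 <= l.2 < `|lab l.1| by [].
move=> /(divz_lab 0) []; rewrite mul0r addr0 => h4 h5.
rewrite /cross /= h4 h5 mul0r -surjective_pairing.
case: nu hf {h1 h2 IH E hnu} => [_|l' nu hf] /=; first by rewrite /shift /= add0r.
case: ifP => [/eqP El|_]; last by rewrite /shift /= add0r.
by rewrite /= El eqxx in hf.
Qed.

Definition nf g : state := sval (cid (nf_exists g)).

Lemma nf_ok g : okst S r r (nf g).
Proof. by rewrite /nf; case: cid => s []. Qed.

Lemma evs_nf g : evs S r (nf g) = g.
Proof. by rewrite /nf; case: cid => s []. Qed.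

Lemma nf_evs s : okst S r r s -> nf (evs S r s) = s.
Proof. by move=> hs; apply: evs_inj => //; [apply: nf_ok|apply: evs_nf]. Qed.

Lemma nf_al g v k : nf (g * al v k)%g = ash v k (nf g).
Proof.
apply: evs_inj; [exact: nf_ok|exact/ash_ok/nf_ok|].
by rewrite evs_nf evs_ash ?evs_nf ?nf_ok.
Qed.

Lemma nf_tau g d : nf (g * tau d)%g = acr d (nf g).
Proof.
apply: evs_inj; [exact: nf_ok|exact/acr_ok/nf_ok|].
by rewrite evs_nf evs_acr ?evs_nf ?nf_ok.
Qed.

End RootedNormalForms.

(** * Cuts of the Bass-Serre tree *)

Section RealHom.
Variables (R : realType) (G : groupType) (phi : G -> R).
Hypothesis hphi : real_hom phi.

Lemma homM x y : phi (x * y)%g = phi x + phi y. Proof. exact: hphi. Qed.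

Lemma hom1 : phi 1%g = 0.
Proof. by have := homM 1%g 1%g; rewrite mulg1; lra. Qed.

Lemma homV x : phi x^-1%g = - phi x.
Proof. by have := homM x^-1%g x; rewrite mulVg hom1; lra. Qed.

Lemma homX x n : phi (x ^+ n)%g = phi x *+ n.
Proof.
by elim: n => [|n IH]; rewrite ?expg0 ?hom1 // expgS homM IH mulrS.
Qed.

Lemma hom_unbounded : (exists g, phi g != 0) -> forall C, exists g, C <= phi g.
Proof.
move=> [g0 g0n] C.
have [g gp] : exists g, 0 < phi g.
  case: (ltgtP (phi g0) 0) g0n => // h _; last by exists g0.
  by exists g0^-1%g; rewrite homV; lra.
exists (g ^+ (Num.bound (`|C| / phi g)))%g; rewrite homX -mulr_natl.
have h : 0 <= `|C| / phi g by apply: divr_ge0 => //; apply: ltW.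
have := archi_boundP h; rewrite ltr_pdivrMr // => /ltW.
by apply: le_trans; rewrite ler_norm.
Qed.

End RealHom.

Section Cuts.
Variables (Gamma : graph_of_groups) (T : {set gg_edge Gamma}) (G : groupType).
Variable S : cyclic_splitting T G.
Hypothesis hT : spanning_tree T.
Local Notation V := (gg_vert Gamma).
Local Notation D := (gg_edge Gamma * bool)%type.
Local Notation ds := (@dart_src Gamma).
Local Notation dt := (@dart_tgt Gamma).
Local Notation drev := (@dart_rev Gamma).
Local Notation lab := (lab S).
Local Notation al := (al S).
Local Notation tau := (tau S).
Local Notation state := (state Gamma).
Local Notation link := (link Gamma).
Local Notation ev := (ev S).
Local Notation adm := (adm S).

(** The link at the root, hence the last entry of the list. *)
Definition firstl (nu : seq link) : option link := ohead (rev nu).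

Lemma firstl_cons l nu : nu <> [::] -> firstl (l :: nu) = firstl nu.
Proof.
rewrite /firstl rev_cons; case/lastP: nu => // nu x _.
by rewrite rev_rcons.
Qed.

Lemma firstl_cat1 nu l : firstl (nu ++ [:: l]) = Some l.
Proof. by rewrite /firstl rev_cat. Qed.

Lemma adm_forget v l p : adm v (Some l) p ->
  adm v None p /\ firstl p <> Some l.
Proof.
elim: p => [//|l' nu IH] /= /andP[/IH[-> h2] h3].
case: nu {IH} h2 h3 => [|x nu] h2 /= h3; last by rewrite firstl_cons.
move: h3; rewrite /okl /firstl /= => /and3P[-> -> h]; split=> //.
by move=> E; rewrite E eqxx in h.
Qed.

(** A crossing alters only the far end of the path. *)
Lemma firstl_cross r d s : okst S r (ds d) s ->
  [\/ firstl (cross S d s).1 = firstl s.1, s.1 = [::] | (cross S d s).1 = [::]].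
Proof.
move=> hs; case: (crossP hs) => [_|l nu q -> _ _ _] /=.
  by case: (s.1) => [|l nu]; [constructor 2|constructor 1; apply: firstl_cons].
by case: nu => [|l' nu]; [constructor 3|constructor 1; apply/esym/firstl_cons].
Qed.

Variables (R : realType) (phi : G -> R).
Hypothesis hphi : real_hom phi.
Hypothesis phi_al : forall v k, phi (al v k) = 0.

Local Notation phiM := (homM hphi).

Lemma phi_evs r s : phi (evs S r s) = phi (ev s.1).
Proof. by rewrite /evs phiM phi_al addr0. Qed.

(** Empty paths have height 0 and tree edges keep the height, so the path never becomes empty. *)
Lemma firstl_walk r u p v s : dwalk T u p v -> okst S r u s ->
  phi (evs S r s) != 0 -> firstl (walk S p s).1 = firstl s.1.
Proof.
elim: p u s => [//|d p IH] u s /= /and3P[/eqP<- dT hp] hs hn.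
have E : evs S r (cross S d s) = evs S r s.
  by rewrite evs_cross // tau_tree // mulg1.
rewrite (IH _ _ hp) ?cross_ok ?E //.
case: (firstl_cross hs) => // h; move: hn.
  by rewrite phi_evs h /= hom1 ?eqxx.
by rewrite -E phi_evs h /= hom1 ?eqxx.
Qed.

Section Root.
Variable r : V.
Local Notation nf := (@nf _ _ _ S hT r).

Lemma firstl_bwd v s : okst S r v s -> phi (evs S r s) != 0 ->
  firstl (bwd S hT r v s).1 = firstl s.1.
Proof. exact: firstl_walk (dwalk_rev (gam_walk hT r v)). Qed.

Lemma firstl_fwd v s : okst S r r s -> phi (evs S r s) != 0 ->
  firstl (fwd S hT r v s).1 = firstl s.1.
Proof. exact: firstl_walk (gam_walk hT r v). Qed.

Lemma firstl_nf_al g v k : phi g != 0 ->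
  firstl (nf (g * al v k)%g).1 = firstl (nf g).1.
Proof.
move=> h; rewrite nf_al /ash firstl_bwd ?shift_ok ?fwd_ok ?nf_ok //.
  by rewrite firstl_fwd ?nf_ok ?evs_nf.
by rewrite evs_shift phiM phi_al addr0 evs_fwd ?nf_ok // evs_nf.
Qed.

Lemma firstl_nf_tau g d : phi g != 0 -> phi g + phi (tau d) != 0 ->
  firstl (nf (g * tau d)%g).1 = firstl (nf g).1.
Proof.
move=> h h'; have hf := fwd_ok hT (ds d) (nf_ok S hT r g).
have E : evs S r (fwd S hT r (ds d) (nf g)) = g.
  by rewrite evs_fwd ?nf_ok // evs_nf.
rewrite nf_tau /acr firstl_bwd ?cross_ok //; last first.
  by rewrite evs_cross // E phiM.
rewrite -(firstl_fwd (ds d) (nf_ok S hT r g)) ?evs_nf //.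
case: (firstl_cross hf) => // hn.
  by move: h; rewrite -E phi_evs hn /= hom1 ?eqxx.
by move: h'; rewrite -phiM -E -evs_cross // phi_evs hn /= hom1 ?eqxx.
Qed.

(** Write s as a product of generators: when g is high enough, all its products with the initial
    segments have nonzero height, so the link at the root never changes. *)
Lemma cut_bound l s : exists C, forall g, C < phi g ->
  (firstl (nf (g * s)%g).1 == Some l) = (firstl (nf g).1 == Some l).
Proof.
elim/(gen_ind S): s => [|s v k [C hC]|s d [C hC]].
- by exists 0 => g _; rewrite mulg1.
- exists (Num.max C (- phi s)) => g; rewrite gt_max => /andP[h1 h2].
  rewrite mulgA firstl_nf_al ?hC // phiM gt_eqF //; lra.
- exists (Num.max C (- phi s + `|phi (tau d)|)) => g.
  rewrite gt_max => /andP[h1 h2].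
  have := ler_norm (- phi (tau d)); rewrite normrN => h3.
  have := normr_ge0 (phi (tau d)) => h4.
  by rewrite mulgA firstl_nf_tau ?hC // ?phiM gt_eqF //; lra.
Qed.

Lemma cut_bound_set l (A : set G) : finite_set A ->
  exists C, forall s g, A s -> C < phi g ->
  (firstl (nf (g * s)%g).1 == Some l) = (firstl (nf g).1 == Some l).
Proof.
move=> /finite_seqP[L ->]; elim: L => [|s L [C hC]]; first by exists 0.
have [C' hC'] := cut_bound l s.
exists (Num.max C C') => x g /=; rewrite inE gt_max => hx /andP[h1 h2].
by case/orP: hx => [/eqP->|hx]; [apply: hC'|apply: hC].
Qed.

Lemma nf_of_path nu : adm r None nu -> phi (ev nu) != 0 ->
  exists g, phi g = phi (ev nu) /\ firstl (nf g).1 = firstl nu.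
Proof.
move=> ha hn; have hs : okst S r (endv r nu) (nu, 0) by rewrite /okst /= ha eqxx.
have hn' : phi (evs S r (nu, 0)) != 0 by rewrite phi_evs.
exists (evs S r (nu, 0)); rewrite phi_evs; split=> //.
rewrite -(evs_bwd hT hs) nf_evs; last exact: bwd_ok.
exact: firstl_bwd.
Qed.

End Root.

Definition unbounded_from (v : V) (F : option link) : Prop :=
  forall C : R, exists p, adm v F p /\ C <= phi (ev p).
(** The height is unbounded above on the half-tree beyond the edge of t_d. *)
Definition good (d : D) : Prop := unbounded_from (dt d) (Some (drev d, 0)).

Lemma lab_norm_gt0 d : 0 < `|lab d|.
Proof. by rewrite normr_gt0 lab_neq0. Qed.

(* The cut: the elements whose normal form, rooted at the source of d, starts
   with the link (d, 0). *)
Lemma good_disconnected d (A : set G) : good d -> good (drev d) ->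
  finite_set A -> ~ induced_connected (cayley_edge A) [set g | 0 <= phi g].
Proof.
move=> gd gd' fA; pose r := ds d.
have [C hC] := cut_bound_set r (d, 0) fA.
have big1 B : exists g, B <= phi g /\ firstl (nf S hT r g).1 = Some (d, 0).
  (* The bound 1 keeps the height nonzero, as [nf_of_path] requires. *)
  have [p [hp hB]] := gd (Num.max B 1 - phi (tau d)).
  have ha : adm r None (p ++ [:: (d, 0)]).
    by rewrite adm_cat /= /okl /= eqxx lab_norm_gt0.
  have E : phi (ev (p ++ [:: (d, 0)])) = phi (tau d) + phi (ev p).
    by rewrite ev_cat /= al0 !mul1g phiM.
  have hb : 1 <= Num.max B 1 /\ B <= Num.max B 1 by rewrite !le_max !lexx orbT.
  have [|g [h1 h2]] := nf_of_path ha; first by rewrite E gt_eqF //; lra.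
  by exists g; rewrite h2 firstl_cat1 h1 E; split=> //; lra.
have big2 B : exists g, B <= phi g /\ firstl (nf S hT r g).1 <> Some (d, 0).
  have [p []] := gd' (Num.max B 1); rewrite dart_revK dart_tgt_rev.
  move=> /adm_forget[ha hf] hB.
  have hb : 1 <= Num.max B 1 /\ B <= Num.max B 1 by rewrite !le_max !lexx orbT.
  have [|g [h1 h2]] := nf_of_path ha; first by rewrite gt_eqF //; lra.
  by exists g; rewrite h2 h1; split=> //; lra.
(* Left translation by g1 lifts {phi >= 0} above C, where no Cayley edge changes the side of the
   cut, while the translates x and y of two of its points lie on different sides. *)
have [g1 [hg1 _]] := big1 (C + 1).
have [x [hx fx]] := big1 (phi g1).
have [y [hy fy]] := big2 (phi g1).
move=> /(_ (g1^-1 * x)%g (g1^-1 * y)%g) /=.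
rewrite !phiM !homV // !(addrC (- _)) !subr_ge0 => /(_ hx hy).
suff key a b : Relation_Operators.clos_refl_sym_trans G
      (fun a b => [/\ 0 <= phi a, 0 <= phi b & cayley_edge A a b]) a b ->
    (firstl (nf S hT r (g1 * a)%g).1 == Some (d, 0)) =
    (firstl (nf S hT r (g1 * b)%g).1 == Some (d, 0)).
  by move=> /key; rewrite !mulgA mulgV !mul1g fx eqxx => /esym/eqP.
elim=> {a b} [a b [ha hb [s As ->]]|//|a b _ ->//|a b c _ -> _ ->//].
rewrite mulgA; apply/esym/hC => //.
by rewrite phiM (lt_le_trans _ (lerD hg1 ha)) // addr0 ltrDl.
Qed.

(** * Orientation when no edge is unbounded on both sides *)

Section Unique.
Hypothesis phi_n0 : exists g, phi g != 0.
Hypothesis no_good_pair : forall d, good d -> ~ good (drev d).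

Lemma unbounded_root v : unbounded_from v None.
Proof.
move=> C; have [g hg] := hom_unbounded hphi phi_n0 C.
exists (nf S hT v g).1; split; first by case/andP: (nf_ok S hT v g).
by rewrite -(phi_evs v) evs_nf.
Qed.

(** Finitely many darts leave v and residues do not affect the height, so bounds beyond each dart
    would bound phi on G. *)
Lemma good_at v : exists2 d, ds d = v & good d.
Proof.
apply: contrapT => hn.
have hC d : exists C : R, ds d = v -> forall p,
    adm (dt d) (Some (drev d, 0)) p -> phi (ev p) < C.
  have [E|ne] := pselect (ds d = v); last by exists 0.
  have /existsNP[C hC] : ~ good d by move=> hg; apply: hn; exists d.
  exists C => _ p hp; rewrite ltNge; apply/negP => h.
  by apply: hC; exists p.
pose C d := sval (cid (hC d)).
have CP d : ds d = v -> forall p, adm (dt d) (Some (drev d, 0)) p ->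
  phi (ev p) < C d by rewrite /C; case: cid.
pose B : R := \sum_(d : D) (`|C d| + `|phi (tau d)|).
have [p [hp hB]] := unbounded_root v (B + 1).
have B0 : 0 <= B by apply: sumr_ge0 => d _; apply: addr_ge0.
case/lastP: p hp hB => [|p [d i]]; first by rewrite /= hom1 //; lra.
rewrite -cats1 adm_cat ev_cat /= => /andP[/andP[/eqP E _ ] hp].
rewrite mul1g !phiM phi_al add0r.
have := CP d E p hp; suff : `|C d| + `|phi (tau d)| <= B.
  by have := ler_norm (C d); have := ler_norm (phi (tau d)); lra.
rewrite /B (bigD1 d) //= lerDl; apply: sumr_ge0 => ? _; exact: addr_ge0.
Qed.

(** As [l] differs from (d, 0), the half-tree beyond [l] lies in the one behind d. *)
Lemma good_other d (l : link) : good l.1 -> ds l.1 = ds d ->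
  0 <= l.2 < `|lab l.1| -> l <> (d, 0) -> good (drev d).
Proof.
move=> gl E hl ne C; have [p [hp hC]] := gl (C - phi (tau l.1)).
exists (p ++ [:: l]); rewrite adm_cat ev_cat dart_revK dart_tgt_rev /=.
rewrite /okl E eqxx hl hp !andbT mul1g !phiM phi_al; split; last by lra.
by apply/eqP => -[].
Qed.

(** [f v] is a good dart at v. With a label of absolute value at least 2, (f v, 1) would be a second
    good link at v, whence a good pair; a dart chosen at neither of its ends would be good in both
    directions. *)
Lemma good_orientation : exists f : V -> D,
  [/\ forall v, ds (f v) = v, forall v, `|lab (f v)| = 1 &
      forall d, d = f (ds d) \/ drev d = f (dt d)].
Proof.
have hv v : exists d, ds d = v /\ good d by have [d h1 h2] := good_at v; exists d.
pose f v := sval (cid (hv v)).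
have fP v : ds (f v) = v /\ good (f v) by rewrite /f; case: cid.
exists f; split.
- by move=> v; case: (fP v).
- move=> v; have [E g] := fP v; apply/eqP; rewrite eq_le.
  have := lab_norm_gt0 (f v); rewrite gtz0_ge1 => ->; rewrite andbT leNgt.
  apply/negP => h; apply: (no_good_pair g).
  exact: (@good_other _ (f v, 1)).
- move=> d; have [E g] := fP (ds d).
  have [|ne] := eqVneq d (f (ds d)); [by left|right].
  have gd : good (drev d).
    apply: (@good_other d (f (ds d), 0)) => //=; first by rewrite lab_norm_gt0.
    by move=> [E1]; move: ne; rewrite E1 eqxx.
  apply: contrapT => ne'; have [E' g'] := fP (dt d).
  apply: (no_good_pair gd).
  apply: (@good_other (drev d) (f (dt d), 0)) => //=.
  + by rewrite dart_src_rev.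
  + by rewrite lab_norm_gt0.
  + by move=> [E1]; apply: ne'.
Qed.

End Unique.
End Cuts.

(** * Ascending HNN extensions *)

Section Ascending.
Variables (G : groupType) (A : int -> G) (t : G).
Local Open Scope group_scope.
Hypothesis AD : forall k l, A (k + l)%R = A k * A l.
Hypothesis At : forall k, exists l, A k ^ t = A l.
Hypothesis gen : forall P : G -> Prop, P 1 -> (forall g k, P g -> P (g * A k)) ->
  (forall g, P g -> P (g * t)) -> (forall g, P g -> P (g * t^-1)) ->
  forall g, P g.

(* The normal closure of A: an ascending union of conjugates of A. *)
Let N (x : G) : Prop := exists n k, x ^ (t ^+ n) = A k.

Let A0 : A 0 = 1.
Proof. by apply: (mulIg (A 0)); rewrite -AD mul1g add0r. Qed.

Let AV k : (A k)^-1 = A (- k)%R.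
Proof. by apply: mulg1_eq; rewrite -AD addrN A0. Qed.

Let Atn k m : exists l, A k ^ (t ^+ m) = A l.
Proof.
elim: m => [|m [l IH]]; first by exists k; rewrite expg0 conjg1.
by have [l' h] := At l; exists l'; rewrite expgSr conjgM IH.
Qed.

Let common x y : N x -> N y -> exists n k l, x ^ (t ^+ n) = A k /\ y ^ (t ^+ n) = A l.
Proof.
move=> [n [k hx]] [m [l hy]]; have [k' h1] := Atn k m; have [l' h2] := Atn l n.
exists (n + m)%N, k', l'; split; first by rewrite expgnDr conjgM hx.
by rewrite addnC expgnDr conjgM hy.
Qed.

Let NA k : N (A k). Proof. by exists 0%N, k; rewrite expg0 conjg1. Qed.

Let N1 : N 1. Proof. by rewrite -A0. Qed.

Let NM x y : N x -> N y -> N (x * y).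
Proof.
move=> hx hy; have [n [k [l [h1 h2]]]] := common hx hy.
by exists n, (k + l)%R; rewrite conjMg h1 h2 AD.
Qed.

Let NV x : N x -> N x^-1.
Proof. by move=> [n [k h]]; exists n, (- k)%R; rewrite conjVg h AV. Qed.

Let Ncomm x y : N x -> N y -> commute x y.
Proof.
move=> hx hy; have [n [k [l [h1 h2]]]] := common hx hy.
apply: (@conjg_inj _ (t ^+ n)).
by rewrite !conjMg h1 h2 -!AD addrC.
Qed.

Let NJ g x : N x -> N (x ^ g).
Proof.
elim/gen: g x => [|g k IH|g IH|g IH] x hx; rewrite ?conjg1 // conjgM.
- by rewrite conjgE; apply/NM; [apply/NV/NA|apply/NM; [apply: IH|apply: NA]].
- have [n [k h]] := IH _ hx; have [l h'] := At k.
  by exists n, l; rewrite -conjgM -expgS expgSr conjgM h.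
- have [n [k h]] := IH _ hx; exists n.+1, k.
  by rewrite -conjgM expgS mulgA mulVg mul1g h.
Qed.

Let commMr (x y z : G) : [~ x, y * z] = [~ x, z] * [~ x, y] ^ z.
Proof. by rewrite /commg /conjg !invgM !mulgA !mulgK. Qed.

Let commMl (x y z : G) : [~ x * y, z] = [~ x, z] ^ y * [~ y, z].
Proof. by rewrite /commg /conjg !invgM !mulgA !mulgK. Qed.

Let Nt x : N [~ x, t].
Proof.
elim/gen: x => [|g k IH|g IH|g IH]; rewrite ?comm1g // commMl;
  apply: NM; try exact: NJ.
- by rewrite commgEl; apply: NM; [apply/NV/NA|apply/NJ/NA].
- by rewrite commgg.
- have /commgP/eqP -> // : commute t^-1 t by apply/commute_sym/commuteV.
Qed.

Let NR x y : N [~ x, y].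
Proof.
elim/gen: y => [|g k IH|g IH|g IH]; rewrite ?commg1 // commMr;
  (apply: NM; last exact: NJ).
- by rewrite commgEr; apply: NM; [apply/NJ/NV/NA|apply/NA].
- exact: Nt.
- have := commMr x t t^-1; rewrite mulgV commg1 => /esym/mulg1_eq E.
  by rewrite -[X in N X]invgK E; apply/NV/NJ/Nt.
Qed.

(** N is normal, being stable under conjugation by the generators, and abelian, since a high power
    of t conjugates any two of its elements into A. Modulo N the group is generated by t, so
    commutators lie in N. *)
Lemma ascending_solvable : solvable_group G.
Proof.
have d1 x : derived_series (G := G) 1 x -> N x.
  move=> h; apply: (h N); first by split=> // y z hy hz; apply/NM/NV.
  by move=> y [u [v [_ _ ->]]]; apply: NR.
exists 2%N; apply/seteqP; split=> x /=; last by move=> -> H [].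
move=> h; apply: (h [set 1]); first by split=> // y z /= -> ->; rewrite mulgV.
move=> y [u [v [/d1 hu /d1 hv ->]]] /=.
exact/eqP/commgP/Ncomm.
Qed.

End Ascending.

Section Oriented.
Variables (Gamma : graph_of_groups) (T : {set gg_edge Gamma}) (G : groupType).
Variable S : cyclic_splitting T G.
Hypothesis hT : spanning_tree T.
Local Notation V := (gg_vert Gamma).
Local Notation D := (gg_edge Gamma * bool)%type.
Local Notation ds := (@dart_src Gamma).
Local Notation dt := (@dart_tgt Gamma).
Local Notation drev := (@dart_rev Gamma).
Local Notation lab := (lab S).
Local Notation al := (al S).
Local Notation tau := (tau S).

Variable f : V -> D.
Hypotheses (f_src : forall v, ds (f v) = v) (f_lab : forall v, `|lab (f v)| = 1)
  (f_or : forall d, d = f (ds d) \/ drev d = f (dt d)).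
Variable e : gg_edge Gamma.
Hypothesis eT : e \notin T.

(* The edges d_v = f v are all those of the graph and point, inside T, towards
   the single vertex w whose edge d_w is not in T. *)
Lemma oriented_solvable : solvable_group G.
Proof.
have [w wT] : exists w, (f w).1 \notin T.
  case: (f_or (e, false)) => h; first by exists (ds (e, false)); rewrite -h.
  by exists (dt (e, false)); rewrite -h.
(* Impredicative form of: iterating f leads from u to w along T. *)
pose reach u := forall P : V -> Prop, P w ->
  (forall v, (f v).1 \in T -> P (dt (f v)) -> P v) -> P u.
have reachS u : (f u).1 \in T -> reach (dt (f u)) -> reach u.
  by move=> uT h P Pw PS; exact: (PS _ uT (h P Pw PS)).
have reach_inv u : reach u -> u = w \/ (f u).1 \in T /\ reach (dt (f u)).
  move=> h; apply: (h (fun u => u = w \/ (f u).1 \in T /\ reach (dt (f u)))).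
    by left.
  move=> v vT [E|[h1 h2]]; right; split=> //; first by rewrite E => P.
  exact: reachS.
(* Either d = f (ds d), so that [ds d] is not w and its route passes through [dt d], or f leads from
   [dt d] back to [ds d]. *)
have step d : d.1 \in T -> reach (ds d) -> reach (dt d).
  move=> dT hd; case: (f_or d) => E; last first.
    by apply: reachS; rewrite -E // dart_tgt_rev.
  case: (reach_inv _ hd) => [E'|[_]]; last by rewrite -E.
  by move: wT; rewrite -E' -E dT.
have reach_all u : reach u.
  have [_ /(_ w u) /connectP[p hp ->] _] := hT.
  have : reach w by move=> P.
  elim: p (w) hp => //= y p IH x /andP[/existsP[d /and3P[dT /eqP du /eqP dy]] hp] hx.
  by apply: (IH y hp); rewrite -dy; apply: step => //; rewrite du.
have unique u : (f u).1 \notin T -> u = w.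
  by case: (reach_inv u (reach_all u)) => [//|[->]].
have lab2 v : lab (f v) * lab (f v) = 1 by have := f_lab v; lia.
(* As the label at v is 1 or -1, t conjugates the whole vertex group at v into the next one; along T
   all of them end up in the one at w. *)
have push v k : al v k = (tau (f v) *
    al (dt (f v)) (lab (drev (f v)) * (lab (f v) * k)) * (tau (f v))^-1)%g.
  by rewrite tau_rel f_src mulrA lab2 mul1r mulgK.
have into_w u : forall k, exists l, al u k = al w l.
  apply: (reach_all u (fun u => forall k, exists l, al u k = al w l)) => [k|v vT IH k]; first by exists k.
  rewrite push tau_tree // invg1 mulg1 mul1g; exact: IH.
apply: (@ascending_solvable G (al w) (tau (f w))).
- exact: alD.
- move=> k; have [l hl] := into_w (dt (f w)) (lab (drev (f w)) * (lab (f w) * k)).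
  by exists l; rewrite push /conjg !mulgA mulVg mul1g mulgVK hl.
- move=> P P1 PA Pt PtV g; elim/(gen_ind S): g => [//|g v k IH|g d IH].
    by have [l ->] := into_w v k; apply: PA.
  have [dT|dT] := boolP (d.1 \in T); first by rewrite tau_tree // mulg1.
  case: (f_or d) => E.
    by rewrite E (unique (ds d)) -?E //; apply: Pt.
  rewrite -[d](@dart_revK Gamma) E tau_rev (unique (dt d)) -?E //; exact: PtV.
Qed.

End Oriented.

(** * Hyperbolic central elements *)

Section Center.
Variables (Gamma : graph_of_groups) (T : {set gg_edge Gamma}) (G : groupType).
Variable S : cyclic_splitting T G.
Hypothesis hT : spanning_tree T.
Local Notation V := (gg_vert Gamma).
Local Notation D := (gg_edge Gamma * bool)%type.
Local Notation ds := (@dart_src Gamma).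
Local Notation dt := (@dart_tgt Gamma).
Local Notation drev := (@dart_rev Gamma).
Local Notation lab := (lab S).
Local Notation al := (al S).
Local Notation tau := (tau S).
Local Notation link := (link Gamma).
Local Notation ev := (ev S).
Local Notation adm := (adm S).
Local Notation okl := (okl S).

Lemma adm_first v F l nu : adm v F (nu ++ [:: l]) =
  okl v F l && adm (dt l.1) (Some (drev l.1, 0)) nu.
Proof. by rewrite adm_cat. Qed.

Lemma ev_first l nu : ev (nu ++ [:: l]) = (al (ds l.1) l.2 * tau l.1 * ev nu)%g.
Proof. by rewrite ev_cat /= mul1g. Qed.

Lemma adm_forbid v l p : adm v None p -> firstl p <> Some l -> adm v (Some l) p.
Proof.
elim: p => [//|l' nu IH] /= /andP[h1 h2] h3.
case: nu h1 h2 h3 IH => [|x nu] h1 h2 h3 IH.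
  move: h2; rewrite /okl /= => /and3P[-> -> _].
  by apply/eqP.
by rewrite h2 andbT; apply: IH => //; rewrite firstl_cons // in h3.
Qed.

(* Left multiplication by a_v^c only rotates the residues of the links. *)
Lemma adm_push mu v F c : adm v F mu ->
  (forall l, F = Some l -> l.2 = 0 /\ exists q, c = q * lab l.1) ->
  exists nu c', [/\ adm v F nu, endv v nu = endv v mu,
    (al v c * ev mu = ev nu * al (endv v mu) c')%g &
    firstl nu = omap (fun l : link => (l.1, ((c + l.2) %% lab l.1)%Z)) (firstl mu)].
Proof.
elim/last_ind: mu v F c => [|mu l IH] v F c.
  by move=> _ _; exists [::], c; rewrite /= mulg1 mul1g.
(* With j the old residue, a^(c + j) t = a^i t b^(lab (drev l.1) * q). The exponent handed on is a
   multiple of the label of the dart forbidden next, so residues on this dart do not change. *)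
rewrite -cats1 adm_first => /andP[hl hmu] hF.
pose i := ((c + l.2) %% lab l.1)%Z; pose q := ((c + l.2) %/ lab l.1)%Z.
have [|nu [c' [h1 h2 h3 _]]] := IH _ _ (lab (drev l.1) * q) hmu.
  by move=> _ [<-]; split=> //; exists q; rewrite mulrC.
exists (nu ++ [:: (l.1, i)]), c'; split.
- rewrite adm_first h1 andbT; case/and3P: hl => h4 h5 h6.
  rewrite /okl /= h4 modz_ge0 ?ltz_mod ?lab_neq0 //=.
  case: F hF h6 => [[d j]|] //= hF h6.
  have [/= j0 [q' hc]] := hF _ erefl; rewrite j0 in hF h6 *.
  apply: contraNneq h6 => -[E Ei]; apply/eqP; congr Some.
  have hi : i = l.2.
    by rewrite /i hc -E addrC; have [_ ->] := divz_lab q' h5.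
  by rewrite -E -Ei hi; case: (l).
- by rewrite !endv_cat.
- rewrite !ev_first /= endv_cat /= -[RHS]mulgA -h3 !mulgA; congr (_ * _)%g.
  case/and3P: hl => /eqP E _ _.
  rewrite -[RHS]mulgA tau_rel E mulgA -!alD; congr (al _ _ * _)%g.
  by rewrite {1}(divz_eq (c + l.2) (lab l.1)) mulrC addrC.
- by rewrite !firstl_cat1.
Qed.

Variable z : G.
Hypotheses (zC : group_center G z) (z_hyp : forall v k, z <> al v k).

Local Notation nfz v := (nf S hT v z).

Lemma nfz_ok v : adm v None (nfz v).1 /\ endv v (nfz v).1 = v.
Proof. by have := nf_ok S hT v z; rewrite /okst => /andP[-> /eqP]. Qed.

Lemma nfzE v : (ev (nfz v).1 * al v (nfz v).2)%g = z.
Proof. by have := evs_nf S hT v z; rewrite /evs; have [_ ->] := nfz_ok v. Qed.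

Lemma nfz_neq0 v : (nfz v).1 <> [::].
Proof. by move=> E; have := nfzE v; rewrite E mul1g => /esym; apply: z_hyp. Qed.

(** Compare first links in a_v z = z a_v: the left factor turns the residue i into (1 + i) mod lab
    d, the right one leaves it alone. Hence lab d divides 1. *)
Lemma nfz_first v : exists d, [/\ ds d = v, `|lab d| = 1 &
  firstl (nfz v).1 = Some (d, 0)].
Proof.
have [ha he] := nfz_ok v; have hE := nfzE v; have := @nfz_neq0 v.
case: (nfz v) ha he hE => /= p k ha he hE.
case/lastP: p ha he hE => [//|nu l]; rewrite -cats1 => ha he hE _.
have [//|mu [c' [h1 h2 h3 h4]]] := @adm_push _ v None 1 ha.
have : (mu, c' + k) = (nu ++ [:: l], k + 1).
  apply: (@evs_inj _ _ _ S hT v).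
  - by rewrite /okst /= h1 h2 he eqxx.
  - by rewrite /okst /= ha he eqxx.
  - rewrite he in h3.
    by rewrite /evs /= h2 he !alD !mulgA -h3 -[LHS]mulgA hE zC.
move=> [Emu _]; move: h4; rewrite Emu firstl_cat1 /= => -[].
move: ha; rewrite adm_first => /andP[/and3P[/eqP E hr _] _].
case: l E hr {he hE h1 h2 h3 Emu} => d i /= E hr [hi].
have l1 : `|lab d| = 1.
  have hd : (lab d %| 1)%Z.
    apply/dvdzP; exists ((1 + i) %/ lab d)%Z.
    by have := divz_eq (1 + i) (lab d); rewrite -hi; lia.
  move: hd; rewrite dvdzE /= dvdn1 => /eqP; lia.
by exists d; rewrite l1; split=> //; congr (Some (_, _)); lia.
Qed.

Lemma center_orientation : exists f : V -> D,
  [/\ forall v, ds (f v) = v, forall v, `|lab (f v)| = 1 &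
      forall d, d = f (ds d) \/ drev d = f (dt d)].
Proof.
pose f v := sval (cid (nfz_first v)).
have fP v : [/\ ds (f v) = v, `|lab (f v)| = 1 & firstl (nfz v).1 = Some (f v, 0)].
  by rewrite /f; case: cid.
exists f; split; [by move=> v; case: (fP v)|by move=> v; case: (fP v)|].
move=> d; have [|/eqP ne] := eqVneq d (f (ds d)); [by left|right].
have [_ _ f1] := fP (ds d); have [_ _ f2] := fP (dt d).
have [ha he] := nfz_ok (ds d); have hE := nfzE (ds d).
(* Prepending t_d^-1 to the normal form of z at [ds d], then multiplying by t_d on the right, gives
   back z, now rooted at [dt d]. The prefix is reduced because d is not [f (ds d)], and it survives
   because z is in no vertex group. *)
pose s := ((nfz (ds d)).1 ++ [:: (drev d, 0 : int)], (nfz (ds d)).2).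
have hs : okst S (dt d) (ds d) s.
  rewrite /okst adm_first endv_cat /= dart_tgt_rev he eqxx andbT.
  rewrite {1}/okl /= dart_src_rev eqxx normr_gt0 lab_neq0 /=.
  rewrite dart_revK; apply: adm_forbid => //.
  by rewrite f1 => -[]; apply/nesym.
have Es : cross S d s = nfz (dt d).
  apply: (@evs_inj _ _ _ S hT (dt d)); first exact: cross_ok; first exact: nf_ok.
  rewrite evs_cross // evs_nf /evs /= ev_first endv_cat /= dart_tgt_rev he.
  by rewrite al0 mul1g -(mulgA _ (ev _)) hE tau_rev -mulgA zC mulKg.
case: (firstl_cross hs); rewrite ?Es.
- by rewrite f2 firstl_cat1 => -[].
- by rewrite /s /=; case: (nfz (ds d)).1.
- by move=> /nfz_neq0.
Qed.

End Center.

(** * Central elements and homomorphisms *)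

Section Subgroups.
Variables (G : groupType) (H : set G).
Hypothesis hH : is_subgroup H.
Local Open Scope group_scope.

Lemma subgroupV x : H x -> H x^-1.
Proof. by case: hH => h1 hD hx; rewrite -div1g; apply: hD. Qed.

Lemma subgroupM x y : H x -> H y -> H (x * y).
Proof.
by move=> hx /subgroupV hy; rewrite -[y]invgK; case: hH => _; apply.
Qed.
End Subgroups.

Section CentralPath.
Variables (R : realType) (G : groupType) (phi : G -> R) (z : G).
Hypotheses (hphi : real_hom phi) (zC : group_center G z) (zpos : 0 < phi z).
Variable A : set G.
Hypotheses (Az : A z) (Agen : subgroup_gen A = setT).
Local Open Scope group_scope.

Let P : set G := [set g | (0 <= phi g)%R].
Let conn := Relation_Operators.clos_refl_sym_trans G
  (fun a b => [/\ P a, P b & cayley_edge A a b]).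

Let zXC n g : commute (z ^+ n) g.
Proof. by apply/commute_sym/commuteX/esym/zC. Qed.

Let phiX x n : phi (x * z ^+ n) = (phi x + phi z *+ n)%R.
Proof. by rewrite (homM hphi) (homX hphi). Qed.

Let conn_z x n : P x -> conn x (x * z ^+ n).
Proof.
move=> Px; have Pn m : P (x * z ^+ m).
  by rewrite /P /= phiX addr_ge0 // mulrn_wge0 // ltW.
elim: n => [|n IH]; first by rewrite expg0 mulg1; apply: Relation_Operators.rst_refl.
apply: Relation_Operators.rst_trans IH _; apply: Relation_Operators.rst_step.
by split=> //; exists z; rewrite // expgSr mulgA.
Qed.

Let high g : exists N, forall n, (N <= n)%N -> P (g * z ^+ n).
Proof.
exists (Num.bound (`|phi g| / phi z)%R) => n hn; rewrite /P /= phiX.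
have h : (0 <= `|phi g| / phi z)%R by apply: divr_ge0 => //; apply: ltW.
have h2 : (`|phi g| <= phi z *+ n)%R.
  rewrite -mulr_natl -ler_pdivrMr //.
  apply: le_trans (ltW (archi_boundP h)) _; by rewrite ler_nat.
by have := ler_norm (- phi g)%R; rewrite normrN; lra.
Qed.

Lemma central_connected : induced_connected (cayley_edge A) P.
Proof.
(* The quantifier on x makes H a subgroup; H contains A because z^n moves past a generator. *)
pose H : set G := [set g | forall x, exists N, forall n, (N <= n)%N ->
  conn (x * z ^+ n) (x * g * z ^+ n)].
have sH : is_subgroup H.
  split=> [x|g h hg hh x].
    by exists 0%N => n _; rewrite mulg1; apply: Relation_Operators.rst_refl.
  have [N1 h1] := hg x; have [N2 h2] := hh (x * (g / h)).
  exists (maxn N1 N2) => n; rewrite geq_max => /andP[n1 n2].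
  apply: Relation_Operators.rst_trans (h1 n n1) _.
  apply: Relation_Operators.rst_sym; have := h2 n n2.
  by rewrite !mulgA mulgVK.
have AH : A `<=` H.
  move=> s As x; have [N1 h1] := high x; have [N2 h2] := high (x * s).
  exists (maxn N1 N2) => n; rewrite geq_max => /andP[n1 n2].
  apply: Relation_Operators.rst_step; split; [exact: h1|exact: h2|].
  by exists s => //; rewrite -!mulgA zXC.
move=> x y Px Py.
have hxy : subgroup_gen A (x^-1 * y) by rewrite Agen.
have [N hN] := hxy H sH AH x.
have := hN N (leqnn N); rewrite mulgA mulgV mul1g => {}hxy.
apply: Relation_Operators.rst_trans (conn_z N Px) _.
apply: Relation_Operators.rst_trans hxy _.
exact/Relation_Operators.rst_sym/conn_z.
Qed.

End CentralPath.

(** * Homomorphisms and center in terms of the splitting *)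

Section Splitting.
Variables (Gamma : graph_of_groups) (T : {set gg_edge Gamma}) (G : groupType).
Variable S : cyclic_splitting T G.
Hypothesis hT : spanning_tree T.
Local Notation V := (gg_vert Gamma).
Local Notation D := (gg_edge Gamma * bool)%type.
Local Notation ds := (@dart_src Gamma).
Local Notation dt := (@dart_tgt Gamma).
Local Notation drev := (@dart_rev Gamma).
Local Notation lab := (lab S).
Local Notation al := (al S).
Local Notation tau := (tau S).

Lemma tree_ind (P : V -> Prop) v : P v ->
  (forall d, d.1 \in T -> P (ds d) -> P (dt d)) -> forall u, P u.
Proof.
move=> Pv Pd u; have [_ /(_ v u) /connectP[p hp ->] _] := hT.
elim: p v Pv hp => //= y p IH x Px /andP[/existsP[d /and3P[dT /eqP du /eqP dy]] hp].
by apply: (IH y) => //; rewrite -dy; apply: Pd => //; rewrite du.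
Qed.

(** Prescribing x allows a central element among the generators, as [central_connected] requires. *)
Lemma finite_generation (x : G) : exists A, finite_generating_set A /\ A x.
Proof.
pose L := x :: [seq al v 1 | v : V] ++ [seq tau d | d : D].
exists [set` L]; split; last by rewrite /= inE eqxx.
split; first by apply/finite_seqP; exists L.
apply/seteqP; split=> // g _ H sH AH.
have Hal v k : H (al v k).
  have h1 : H (al v 1).
    by apply: AH; rewrite /= inE mem_cat; apply/orP; right; rewrite fintype.image_f.
  have hN n : H (al v n%:Z).
    elim: n => [|n IH]; first by rewrite al0; case: sH.
    by rewrite -addn1 PoszD alD; apply: subgroupM.
  case: k => n //; rewrite NegzE alN; apply: subgroupV => //; exact: hN.
have Htau d : H (tau d).
  apply: AH; rewrite /= inE mem_cat; apply/orP; right; apply/orP; right.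
  exact: fintype.image_f.
elim/(gen_ind S): g => [|g v k hg|g d hg]; first by case: sH.
  exact: subgroupM.
exact: subgroupM.
Qed.

Lemma sigma_of_central (R : realType) (phi : G -> R) z : real_hom phi ->
  group_center G z -> phi z != 0 -> exists2 A, finite_generating_set A &
    induced_connected (cayley_edge A) [set g | 0 <= phi g].
Proof.
move=> hphi zC; case: (ltgtP (phi z) 0) => // hz _.
  have [A [[fA gA] Az]] := finite_generation z^-1%g; exists A => //.
  apply: (@central_connected R G phi z^-1%g) => //; last by rewrite (homV hphi); lra.
  by move=> g; apply/commute_sym/commuteV/esym/zC.
have [A [[fA gA] Az]] := finite_generation z; exists A => //.
exact: (@central_connected R G phi z).
Qed.

Section Ratios.
Variables (F : realFieldType) (rho : V -> F).
Hypothesis rho_rel : forall d,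
  (lab d)%:~R * rho (ds d) = (lab (drev d))%:~R * rho (dt d).

Let labF_neq0 d : (lab d)%:~R != 0 :> F.
Proof. by rewrite intr_eq0 lab_neq0. Qed.

Lemma rho_neq0 v : rho v != 0 -> forall u, rho u != 0.
Proof.
move=> hv; apply: (tree_ind hv) => d _ h; apply: contraNneq h => E.
have /eqP := rho_rel d; rewrite E mulr0 mulf_eq0 => /orP[|//].
by rewrite (negbTE (labF_neq0 d)).
Qed.

(** Choose exponents [x u] divisible by all labels with x u * rho u independent of u. The powers
    a_u^(x u) are then equal along T and commute with every t_e. *)
Lemma central_of_ratios v : rho v != 0 ->
  exists2 k, k != 0 & group_center G (al v k).
Proof.
move=> hv.
have hpq u : exists pq : int * int, [/\ pq.1 != 0, pq.2 != 0 &
    pq.1%:~R * rho u = pq.2%:~R * rho v].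
  apply: (@tree_ind (fun u => exists pq : int * int, [/\ pq.1 != 0, pq.2 != 0 &
    pq.1%:~R * rho u = pq.2%:~R * rho v]) v) => [|d _ [[p q] /= [p0 q0 E]]].
    by exists (1, 1).
  exists (lab (drev d) * p, lab d * q); split=> /=; rewrite ?mulf_neq0 ?lab_neq0 //.
  rewrite !intrM mulrAC -rho_rel -(mulrA _ _ (rho v)) -E; ring.
pose pq u := sval (cid (hpq u)).
have pqP u : [/\ (pq u).1 != 0, (pq u).2 != 0 &
    (pq u).1%:~R * rho u = (pq u).2%:~R * rho v] by rewrite /pq; case: cid.
(* L provides the divisibility by the labels, and the products of [(pq w).2] clear the denominators
   of rho u / rho v. *)
pose L := \prod_(d : D) lab d.
pose Q := \prod_(u : V) (pq u).2.
pose x u := L * ((pq u).1 * \prod_(w | w != u) (pq w).2).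
pose c : F := (L * Q)%:~R * rho v.
have L0 : L != 0 by apply/prodf_neq0 => d _; apply: lab_neq0.
have Q0 : Q != 0 by apply/prodf_neq0 => u _; case: (pqP u).
have c0 : c != 0 by rewrite mulf_neq0 // intr_eq0 mulf_neq0.
have xP u : (x u)%:~R * rho u = c.
  rewrite /x /c /Q [in RHS](bigD1 u) //= !intrM.
  have [_ _ E] := pqP u.
  transitivity ((L%:~R * (\prod_(w | w != u) (pq w).2)%:~R) * ((pq u).1%:~R * rho u)).
    ring.
  by rewrite E; ring.
have x_dart d : (tau d * al (dt d) (x (dt d)) = al (ds d) (x (ds d)) * tau d)%g.
  have [j Ej] : exists j, x (ds d) = lab d * j.
    by eexists; rewrite /x /L (bigD1 d) //= -!mulrA; reflexivity.
  rewrite Ej -tau_rel; congr (_ * al _ _)%g.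
  apply/eqP; rewrite -(eqr_int F); apply/eqP.
  have h0 : rho (dt d) != 0 by apply: contraNneq c0 => E; rewrite -(xP (dt d)) E mulr0.
  apply: (mulIf h0); rewrite xP -(xP (ds d)) Ej !intrM.
  by rewrite mulrAC rho_rel; ring.
have xv u : al u (x u) = al v (x v).
  apply: (@tree_ind (fun u => al u (x u) = al v (x v)) v) => // d dT <-.
  by have := x_dart d; rewrite tau_tree // mul1g mulg1.
exists (x v); first by apply: contraNneq c0 => E; rewrite -(xP v) E mul0r.
move=> g; apply/esym; elim/(gen_ind S): g => [|g u k IH|g d IH].
- by rewrite mul1g mulg1.
- by rewrite mulgA -IH -!mulgA -(xv u) -!alD addrC.
- by rewrite mulgA -IH -!mulgA -{1}(xv (dt d)) x_dart xv.
Qed.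

(** G acts on F by translations, a_v by rho v and t_d by theta d; f is the displacement of 0. *)
Lemma hom_lift (theta : D -> F) : (forall d, theta (drev d) = - theta d) ->
  (forall d, d.1 \in T -> theta d = 0) ->
  exists f : G -> F, [/\ forall x y, f (x * y)%g = f x + f y,
    forall v k, f (al v k) = k%:~R * rho v & forall d, f (tau d) = theta d].
Proof.
move=> thN thT.
have [|||||||act [a1 aM aal atau]] := @split_univ _ _ _ S F (fun=> True)
  (fun v k x => x + k%:~R * rho v) (fun d x => x + theta d) => //.
- by move=> v x _; rewrite mul0r addr0.
- by move=> v k l x _; rewrite intrD; ring.
- by move=> d x _; rewrite thN; ring.
- move=> d k x _; rewrite !intrM; have := rho_rel d.
  set a := _%:~R * rho _; set b := _ * rho _ => E.
  transitivity (x + theta d + k%:~R * b); first by rewrite /b; ring.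
  by rewrite -E /a; ring.
- by move=> d x _ dT; rewrite thT // addr0.
have actE g x : act g x = x + act g 0.
  elim/(gen_ind S): g x => [|g v k IH|g d IH] x; first by rewrite !a1 // addr0.
    by rewrite !aM // !aal // IH addrA.
  by rewrite !aM // !atau // IH addrA.
exists (fun g => act g 0); split.
- by move=> x y; rewrite aM // actE.
- by move=> v k; rewrite aal // add0r.
- by move=> d; rewrite atau // add0r.
Qed.

End Ratios.

Section Homs.
Variables (R : realType) (phi : G -> R).
Hypothesis hphi : real_hom phi.

Lemma hom_al v k : phi (al v k) = k%:~R * phi (al v 1).
Proof.
elim/int_ind: k => [|n IH|n IH]; first by rewrite al0 (hom1 hphi) mul0r.
  by rewrite -addn1 PoszD alD (homM hphi) IH intrD; ring.
by rewrite -addn1 PoszD opprD alD (homM hphi) IH alN (homV hphi) intrD; ring.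
Qed.

Lemma hom_rel d :
  (lab d)%:~R * phi (al (ds d) 1) = (lab (drev d))%:~R * phi (al (dt d) 1).
Proof.
rewrite -!hom_al; have := congr1 phi (tau_rel S d 1).
by rewrite !(homM hphi) !mulr1; lra.
Qed.

Lemma hom_ext (psi : G -> R) : real_hom psi ->
  (forall v k, phi (al v k) = psi (al v k)) ->
  (forall d, phi (tau d) = psi (tau d)) -> phi =1 psi.
Proof.
move=> hpsi hal htau g; elim/(gen_ind S): g => [|g v k IH|g d IH].
- by rewrite (hom1 hphi) (hom1 hpsi).
- by rewrite (homM hphi) (homM hpsi) IH hal.
- by rewrite (homM hphi) (homM hpsi) IH htau.
Qed.

(** The values on the a_u satisfy the edge relations; were one nonzero, [central_of_ratios] would
    give a central power on which phi does not vanish. *)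
Lemma hom_center_al : (forall z, group_center G z -> phi z = 0) ->
  forall v k, phi (al v k) = 0.
Proof.
move=> hz v k; rewrite hom_al.
have [->|hv] := eqVneq (phi (al v 1)) 0; first by rewrite mulr0.
have [l l0 /hz] := @central_of_ratios R (fun v => phi (al v 1)) hom_rel v hv.
by rewrite hom_al => /eqP; rewrite mulf_eq0 intr_eq0 (negbTE l0) (negbTE hv).
Qed.

Lemma hom_al_sigma (A : set G) : ~ solvable_group G ->
  (forall v k, phi (al v k) = 0) -> (exists g, phi g != 0) -> finite_set A ->
  ~ induced_connected (cayley_edge A) [set g | 0 <= phi g].
Proof.
move=> hns hal hn fA.
have [[d [g1 g2]]|hd] := pselect (exists d, good S phi d /\ good S phi (drev d)).
  exact: (good_disconnected hT hphi hal g1 g2 fA).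
exfalso; apply: hns.
have [f [f1 f2 f3]] := good_orientation hT hphi hal hn
  (fun d g1 g2 => hd (ex_intro _ d (conj g1 g2))).
(* Otherwise every t_e would be 1 and phi would be zero. *)
have [e eT] : exists e, e \notin T.
  apply: contrapT => he; have [g /negP] := hn; apply; apply/eqP.
  elim/(gen_ind S): g => [|g v k IH|g d IH]; first exact: hom1 hphi.
    by rewrite (homM hphi) hal IH addr0.
  rewrite (homM hphi) IH tau_tree ?(hom1 hphi) ?addr0 //.
  by apply: contrapT => /negP dT; apply: he; exists d.1.
exact: (oriented_solvable hT f1 f2 f3 eT).
Qed.

(** A central z with phi z nonzero would put phi in Sigma, against [hom_al_sigma]. *)
Lemma hom_al_center : ~ solvable_group G -> (forall v k, phi (al v k) = 0) ->
  forall z, group_center G z -> phi z = 0.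
Proof.
move=> hns hal z zC; apply/eqP; apply: contrapT => /negP hz.
have [A [fA _]] := sigma_of_central hphi zC hz.
by apply: hom_al_sigma => //; exists z.
Qed.

End Homs.

(** The labels along T prescribe rho up to scaling. If an edge d0 outside T violated the relation, z
    would lie in no vertex group, and [center_orientation] would make G solvable. *)
Lemma center_ratios : ~ solvable_group G -> group_center G <> [set 1%g] ->
  exists rho : V -> rat, (forall v, rho v != 0) /\ forall d,
  (lab d)%:~R * rho (ds d) = (lab (drev d))%:~R * rho (dt d).
Proof.
move=> hns hZ.
have [z [zC z1]] : exists z, group_center G z /\ z <> 1%g.
  apply: contrapT => h; apply: hZ; apply/seteqP; split=> z /=.
    by move=> zC; apply: contrapT => z1; apply: h; exists z.
  by move=> -> g; rewrite mul1g mulg1.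
have [/card_gt0P[r _] _ _] := hT.
have [gam [_ _ gT]] := tree_paths hT r.
pose lr d : rat := (lab d)%:~R.
have lr0 d : lr d != 0 by rewrite intr_eq0 lab_neq0.
pose rho v : rat := \prod_(d <- gam v) (lr d / lr (drev d)).
have rho0 v : rho v != 0.
  by rewrite prodf_seq_neq0; apply/allP => d _ /=; rewrite mulf_neq0 ?invr_eq0.
have rhoT d : d.1 \in T -> lr d * rho (ds d) = lr (drev d) * rho (dt d).
  move=> /gT[]; rewrite /rho => ->; rewrite -cats1 big_cat big_seq1 /=.
    by field; rewrite lr0.
  by rewrite dart_revK; field; rewrite lr0.
exists rho; split=> // d0; apply: contrapT => hd.
have d0T : d0.1 \notin T by apply/negP => /rhoT.
(* G acts on the rationals by affine maps: a_v translates by rho v, and t_d multiplies by [mu d],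
   the defect of the edge relation. *)
apply: hns; pose mu d := lr (drev d) * rho (dt d) / (lr d * rho (ds d)).
have [|||||||act [a1 aM aal atau]] := @split_univ _ _ _ S rat (fun=> True)
  (fun v k x => x + k%:~R * rho v) (fun d x => mu d * x) => //.
- by move=> v x _; rewrite mul0r addr0.
- by move=> v k l x _; rewrite intrD; ring.
- move=> d x _; rewrite /mu dart_revK dart_src_rev dart_tgt_rev; field.
  by rewrite !rho0 !lr0.
- move=> d k x _; rewrite /mu !intrM -!/(lr _); field.
  by rewrite !rho0 !lr0.
- move=> d x _ dT; rewrite /mu -rhoT // divff ?mul1r //.
  by rewrite mulf_neq0.
have z_hyp v k : z <> al v k.
  (* The images of 0 under z t_d0 and t_d0 z agree, which forces [mu d0] = 1. *)
  move=> zE; have := congr1 (fun g => act g 0) (zC (tau d0)).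
  rewrite /= !aM // zE !aal // !atau // mulr0 !add0r => E.
  have k0 : k%:~R * rho v != 0.
    by rewrite mulf_neq0 // intr_eq0; apply: contra_notN z1 => /eqP k0; rewrite zE k0 al0.
  apply: hd; have : mu d0 = 1 by apply: (mulIf k0); rewrite E mul1r.
  move=> /divr1_eq; rewrite -!/(lr _) => -> //.
have [f [f1 f2 f3]] := center_orientation hT zC z_hyp.
exact: (oriented_solvable hT f1 f2 f3 d0T).
Qed.

End Splitting.

(** * The homomorphisms vanishing on the center *)

Section Rational.
Variables (Gamma : graph_of_groups) (T : {set gg_edge Gamma}) (G : groupType).
Variable S : cyclic_splitting T G.
Hypotheses (hT : spanning_tree T) (hns : ~ solvable_group G).
Variable R : realType.
Local Notation V := (gg_vert Gamma).
Local Notation D := (gg_edge Gamma * bool)%type.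
Local Notation al := (al S).
Local Notation tau := (tau S).

Let W : set (G -> R) :=
  [set phi | real_hom phi /\ forall z, group_center G z -> phi z = 0].

Lemma center_subspace : hom_subspace W.
Proof.
split=> [phi []//||a phi psi [h1 h2] [h3 h4]].
  by split=> // x y; rewrite addr0.
split=> [x y|z zC]; first by rewrite h1 h3; ring.
by rewrite h2 // h4 // mulr0 addr0.
Qed.

(** The homomorphism f with values rho v on a_v and 0 on the t_e spans a complement of W; the
    coefficient is read off at a central power z of some a_v. *)
Lemma center_codim : group_center G <> [set 1%g] -> hom_codim W 1.
Proof.
move=> hZ; have [rho [rho0 hrho]] := center_ratios S hT hns hZ.
have [f [fM fal _]] := hom_lift hrho (theta := fun=> 0)
  (fun _ => esym (oppr0 _)) (fun _ _ => erefl).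
have [/card_gt0P[v _] _ _] := hT.
have [k k0 zC] := central_of_ratios hT hrho (rho0 v).
pose z := al v k; pose c (phi : G -> R) := phi z / ratr (f z).
have fz0 : ratr (f z) != 0 :> R by rewrite fmorph_eq0 fal mulf_neq0 ?intr_eq0.
have hf : real_hom (fun g => ratr (f g) : R) by move=> x y; rewrite fM rmorphD.
exists (fun _ g => ratr (f g)); split=> // phi hphi.
exists (const_mx (c phi)); split=> [|b [_ /(_ z zC)]].
  pose psi g := phi g - \sum_(i < 1) (const_mx (c phi) : 'rV_1) 0 i * ratr (f g).
  have hpsi : real_hom psi by move=> x y; rewrite /psi !big_ord1 hphi hf; ring.
  (* psi vanishes at z, hence at a_v, hence at each a_u by the edge relations along T. *)
  suff hal u l : psi (al u l) = 0.
    by split=> //; apply: (hom_al_center hT hpsi hns hal).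
  rewrite (hom_al S hpsi); have [->|hu] := eqVneq (psi (al u 1)) 0.
    by rewrite mulr0.
  have hv := rho_neq0 hT (rho := fun w => psi (al w 1)) (hom_rel S hpsi) hu v.
  have := hom_al S hpsi v k; rewrite {1}/psi -/z big_ord1 mxE /c divfK // subrr.
  move=> /esym/eqP.
  by rewrite mulf_eq0 intr_eq0 (negbTE k0) (negbTE hv).
rewrite big_ord1 => /eqP; rewrite subr_eq0 => /eqP E.
by apply/rowP => i; rewrite ord1 mxE /c E mulfK.
Qed.

(** Elements of W kill the vertex groups, so they are combinations of the rational homomorphisms
    [chi e] dual to the t_e with e outside T. *)
Lemma center_rational : defined_over_Q W.
Proof.
move=> phi [hphi hz]; have hal := hom_center_al S hT hphi hz.
pose theta (e : gg_edge Gamma) (d : D) : rat :=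
  if (d.1 == e) && (e \notin T) then (-1) ^+ d.2 else 0.
have ex_chi e : exists f : G -> rat, [/\ forall x y, f (x * y)%g = f x + f y,
    forall v k, f (al v k) = 0 & forall d, f (tau d) = theta e d].
  have rel0 (d : D) : (lab S d)%:~R * 0 = (lab S (dart_rev d))%:~R * 0 :> rat.
    by rewrite !mulr0.
  have [||f [f1 f2 f3]] := @hom_lift _ _ _ S rat (fun=> 0) rel0 (theta e).
  - move=> [e' b]; rewrite /theta /=; case: ifP => _; last by rewrite oppr0.
    by case: b; rewrite /= ?expr1 ?expr0 ?opprK.
  - move=> d dT; rewrite /theta; case: eqP => [<-|//].
    by rewrite dT.
  by exists f; split=> // v k; rewrite f2 mulr0.
pose chi e := sval (cid (ex_chi e)).
have chiP e : [/\ forall x y, chi e (x * y)%g = chi e x + chi e y,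
    forall v k, chi e (al v k) = 0 & forall d, chi e (tau d) = theta e d].
  by rewrite /chi; case: cid.
have hchi e : real_hom (fun g => ratr (chi e g) : R).
  by move=> x y; case: (chiP e) => -> _ _; rewrite rmorphD.
exists #|gg_edge Gamma|, (fun i => phi (tau (enum_val i, false))),
  (fun i g => ratr (chi (enum_val i) g)); split.
  move=> i; split; last by move=> g; exists (chi (enum_val i) g).
  split=> //; apply: (hom_al_center (S := S) hT (hchi _) hns) => v k /=.
  by case: (chiP (enum_val i)) => _ -> _; rewrite rmorph0.
apply/funext => g.
rewrite -(big_enum_val (fun e => phi (tau (e, false)) * ratr (chi e g))) /=.
pose psi h := \sum_(e in gg_edge Gamma) phi (tau (e, false)) * ratr (chi e h).
suff: phi =1 psi by apply.
apply: (hom_ext (S := S) hphi); rewrite /psi.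
- move=> x y; rewrite -big_split; apply: eq_bigr => e _.
  by rewrite hchi mulrDr.
- move=> v k; rewrite hal big1 // => e _.
  by case: (chiP e) => _ -> _; rewrite rmorph0 mulr0.
move=> [e b]; rewrite (bigD1 e) //= big1 => [|e' ne]; last first.
  case: (chiP e') => _ _ ->; rewrite /theta /= eq_sym (negbTE ne).
  by rewrite rmorph0 mulr0.
case: (chiP e) => _ _ ->; rewrite addr0 /theta /= eqxx /=.
have [eT|eT] := boolP (e \in T).
  by rewrite !tau_tree // hom1 // mul0r.
case: b; rewrite /= ?expr1 ?expr0 ?rmorphN rmorph1 ?mulr1 //.
by rewrite mulrN1 -(homV hphi) -tau_rev.
Qed.

End Rational.

Theorem proposition3p3 (R : realType) (G : groupType)
    (hGBS : GBS_group G) (hns : ~ solvable_group G) :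
  [/\ BNS_invariant R G = sphere R G `\` sphere_vanishing R (group_center G),
      group_center G = [set 1%g] -> BNS_invariant R G = set0
    & group_center G <> [set 1%g] ->
      exists S : set (set (G -> R)),
        rational_subsphere 1 S /\ BNS_invariant R G = sphere R G `\` S].
Proof.
have [Gamma [T [hT [S]]]] := GBS_splitting hGBS.
have main : BNS_invariant R G = sphere R G `\` sphere_vanishing R (group_center G).
  apply/seteqP; split=> r.
    move=> [phi [hn [A [fA _] hc]] <-]; split; first by exists phi.
    move=> [psi [[hpsi _] hz] E].
    (* The class may have another representative psi that vanishes on the center; phi is a positive
       multiple of it. *)
    have [l l0 El] : ray psi phi.
      by rewrite E; exists 1; rewrite ?ltr01 //; apply/funext => g; rewrite mul1r.
    case: hn => hphi hn; apply: (hom_al_sigma hT hphi hns _ hn fA hc).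
    apply: (hom_center_al S hT hphi) => z zC.
    by rewrite El hz // mulr0.
  move=> [[phi hn <-] hv]; exists phi => //; split=> //.
  have [z [zC hz]] : exists z, group_center G z /\ phi z != 0.
    apply: contrapT => h; apply: hv; exists phi => //; split=> // z zC.
    by apply/eqP; apply: contrapT => /negP hz; apply: h; exists z.
  exact: (sigma_of_central S (proj1 hn) zC hz).
split=> // hZ.
  rewrite main hZ; apply/seteqP; split=> // r [[phi hn <-]] []; exists phi => //.
  by split=> // z ->; apply: hom1; case: hn.
exists (sphere_vanishing R (group_center G)); split=> //.
exists [set phi : G -> R | real_hom phi /\ forall z, group_center G z -> phi z = 0].
split; [exact: center_subspace|exact: (center_codim S hT)|exact: (center_rational S hT)|].
apply/seteqP; split=> r [phi [h1 h2] <-]; exists phi => //.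
  by split=> //; split=> //; case: h1.
by split=> //; case: h1.
Qed.
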